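(* Let $(Y_t)_{t\ge 0}$ be the number-of-customers process of an $M/G/\infty$ queue with arrival rate $\lambda\in(0,\infty)$ and generic service time $S\ge 0$, empty at time $0$, and assume $\mathbb{E}S=\infty$. Define $$k_0=\min\Big\{k\in\mathbb{Z}_+ : \int_0^\infty \big(\mathbb{E}(S\wedge t)\big)^k \exp\big(-\lambda\,\mathbb{E}(S\wedge t)\big)\,dt=\infty\Big\},$$ with the convention $\min\emptyset=+\infty$. Then $$\liminf_{t\to\infty} Y_t = k_0 \quad\text{almost surely}.$$ In particular: (i) if $\int_0^\infty \big(\mathbb{E}(S\wedge t)\big)^k\exp\big(-\lambda\,\mathbb{E}(S\wedge t)\big)\,dt<\infty$ for all integers $k\ge 0$, then the system is transient, i.e. $Y_t\to\infty$ almost surely as $t\to\infty$; (ii) if $\int_0^\infty \exp\big(-\lambda\,\mathbb{E}(S\wedge t)\big)\,dt=\infty$, then the system is recurrent, i.e. almost surely every state $n\in\mathbb{Z}_+$ is visited infinitely often (for every $n\in\mathbb{Z}_+$ the set $\{t\ge 0: Y_t=n\}$ is unbounded).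
   Context: $\mathbb{Z}_+=\{0,1,2,\dots\}$ and $a\wedge b=\min(a,b)$. The $M/G/\infty$ queue: customers arrive according to a Poisson process on $[0,\infty)$ with rate $\lambda$; each customer enters service immediately upon arrival; the service times are i.i.d. nonnegative (finite-valued) random variables, independent of the arrival process, with the same distribution as a generic random variable $S$ (a general distribution). At time $0$ there are no customers in the system. $Y_t$ denotes the number of customers being served at time $t$ (the state of the system at time $t$). Equivalently, take a Poisson point process on $\mathbb{R}_+^2$ with intensity measure $\lambda\,dt\times dF_S(u)$, where $F_S(u)=\mathbb{P}[S\le u]$; a point $(s,u)$ represents a customer arriving at time $s$ with service duration $u$, and $Y_t$ is the number of points $(s,u)$ with $0\le s\le t$ and $u\ge t-s$. *)

(* Defs.v *)
From HB Require Import structures.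
From mathcomp Require Import all_boot all_order all_algebra.
From mathcomp Require Import all_classical all_reals all_analysis.
From mathcomp Require Import measurable_realfun.

Set Implicit Arguments.
Unset Strict Implicit.
Unset Printing Implicit Defensive.

Import Order.TTheory GRing.Theory Num.Theory.
Import numFieldNormedType.Exports.

Local Open Scope classical_set_scope.
Local Open Scope ring_scope.

(* Initial segments of the index set suffice: taking some of the [B i] equal to
   [setT] gives the product rule for every finite subfamily. *)
Definition mutually_independent (d d' : measure_display) (T : measurableType d)
    (U : measurableType d') (R : realType) (P : probability T R)
    (X : nat -> T -> U) : Prop :=
  forall (n : nat) (B : nat -> set U), (forall i, measurable (B i)) ->
    P (\bigcap_(i in `I_n) (X i @^-1` B i)) =
    (\prod_(i < n) P (X i @^-1` B i))%E.

Definition sigma_generated (d d' : measure_display) (T : measurableType d)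
    (U : measurableType d') (X : nat -> T -> U) : set_system T :=
  <<s [set E | exists (n : nat) (B : set U), measurable B /\ E = X n @^-1` B] >>.

Definition independent_sequences (d d' : measure_display) (T : measurableType d)
    (U : measurableType d') (R : realType) (P : probability T R)
    (X X' : nat -> T -> U) : Prop :=
  forall E F : set T, sigma_generated X E -> sigma_generated X' F ->
    P (E `&` F) = (P E * P F)%E.

(* Number of arrivals in ]s, t]; [A n] is the arrival time of customer n. *)
Definition arrivals_in (T : Type) (R : realType) (A : nat -> T -> R)
    (s t : R) (w : T) : \bar R :=
  counting [set n | s < A n w <= t].

(* The points of a Poisson process on [0, +oo[ with constant rate [lambda],
   listed in order.  [poisson_gt0] says that the counting process
   t |-> #{n | A n <= t} vanishes at 0.  A finite increasing list of times is
   extended to a nondecreasing sequence [t] by repeating its last element. *)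
Record poisson_process (d : measure_display) (T : measurableType d)
    (R : realType) (P : probability T R) (lambda : R)
    (A : nat -> {RV P >-> R}) : Prop := PoissonProcess {
  poisson_gt0 : forall w, 0 < A 0%N w ;
  poisson_nondecreasing : forall n w, A n w <= A n.+1 w ;
  poisson_independent_increments : forall t : nat -> R,
    0 <= t 0%N -> (forall i, t i <= t i.+1) ->
    mutually_independent P
      (fun i => arrivals_in A (t i) (t i.+1)) ;
  poisson_increment_law : forall (s t : R) (k : nat), 0 <= s -> s < t ->
    P [set w | arrivals_in A s t w = k%:R%:E] =
    (poisson_pmf (lambda * (t - s)) k)%:E }.

(* [V n] is the service time of the customer arriving at time [A n]. *)
Record MGinfty_queue (d : measure_display) (T : measurableType d)
    (R : realType) (P : probability T R) (lambda : R) (S : {RV P >-> R})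
    (A V : nat -> {RV P >-> R}) : Prop := MGinftyQueue {
  queue_arrivals : poisson_process lambda A ;
  queue_service_ge0 : forall n w, 0 <= V n w ;
  queue_service_law : forall (n : nat) (B : set R), measurable B ->
    distribution P (V n) B = distribution P S B ;
  queue_service_independent : mutually_independent P V ;
  queue_arrival_service_independent : independent_sequences P A V }.

(* Y_t; it is almost surely finite, and equal to +oo when infinitely many
   customers are present. *)
Definition customers (T : Type) (R : realType) (A V : nat -> T -> R)
    (t : R) (w : T) : \bar R :=
  counting [set n | A n w <= t /\ t - A n w <= V n w].

(* E(S /\ t), which is finite for S, t >= 0, so that [fine] is harmless. *)
Definition truncated_mean (d : measure_display) (T : measurableType d)
    (R : realType) (P : probability T R) (S : T -> R) (t : R) : R :=
  fine ('E_P[(fun w => Num.min (S w) t)])%E.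

Definition k_integral (d : measure_display) (T : measurableType d)
    (R : realType) (P : probability T R) (lambda : R) (S : T -> R)
    (k : nat) : \bar R :=
  (\int[lebesgue_measure]_(t in `[0%R, +oo[%classic)
     (truncated_mean P S t ^+ k *
      expR (- (lambda * truncated_mean P S t)))%:E)%E.

(* The infimum of a nonempty set of naturals is its minimum, and the infimum of
   the empty set is +oo. *)
Definition k0 (d : measure_display) (T : measurableType d)
    (R : realType) (P : probability T R) (lambda : R) (S : T -> R) : \bar R :=
  ereal_inf [set k%:R%:E | k in [set k : nat | k_integral P lambda S k = +oo%E]].

(* Main.v *)
(* Cut time into the unit cells ]i, i + 1].  Replacing the arrival times in a
   cell by one of its endpoints bounds the process Y from both sides by counts
   of marked customers, and by thinning such a count is a Poisson variable,
   independent of the past of the process, whose mean lambda * sum P(S >= r)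
   differs from lambda * E(S /\ t) by a bounded amount.  Hence k_integral k is
   comparable with the series of the probabilities that the count at time n is
   at most k.

   If k_integral k is finite, Borel-Cantelli gives Y > k eventually.  If it is
   infinite, let q_j be the probability that the upper count at time j is at
   most k.  Decomposing according to the first time i >= a at which this
   happens, and since after time i the process is at least a fresh copy of
   itself, sum_(a <= j < N) q_j <= P(it happens in [a, N[) * sum_(j < N) q_j;
   as sum q_j = +oo, it happens after time a almost surely.

   If k = 0 is such an index, then Y returns to 0 and is unbounded almost
   surely; along the arrival times, almost surely distinct, it increases by at
   most 1, so that it visits every state on its way up. *)
Require Import Defs.
From HB Require Import structures.
From mathcomp Require Import all_boot all_order all_algebra.
From mathcomp Require Import all_classical all_reals all_analysis.
From mathcomp Require Import measurable_realfun.
From mathcomp Require Import ring lra zify.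

Set Implicit Arguments.
Unset Strict Implicit.
Unset Printing Implicit Defensive.

Import Order.TTheory GRing.Theory Num.Theory.
Import numFieldNormedType.Exports.

Local Open Scope classical_set_scope.
Local Open Scope ring_scope.

(** * Poisson and binomial weights *)

Section poisson_weights.
Context {R : realType}.
Implicit Types (a b p : R) (k n z : nat).

(* Unlike [poisson_pmf], this is the right weight for [a = 0] as well. *)
Definition poi a k : R := a ^+ k / k`!%:R * expR (- a).

Lemma poi_ge0 a k : 0 <= a -> 0 <= poi a k.
Proof. by move=> a0; rewrite !mulr_ge0 ?exprn_ge0 ?expR_ge0. Qed.

Lemma poisson_pmfE a k : 0 < a -> poisson_pmf a k = poi a k.
Proof. by move=> a0; rewrite /poisson_pmf a0. Qed.

Lemma poi0 k : poi 0 k = (k == 0%N)%:R.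
Proof.
by case: k => [|k]; rewrite /poi oppr0 expR0 ?expr0 ?fact0 ?divr1 ?mulr1// expr0n !mul0r.
Qed.

Lemma poi_sum a : 0 <= a -> (\sum_(0 <= k <oo) (poi a k)%:E = 1)%E.
Proof.
rewrite le_eqVlt => /predU1P[<-|a0].
  rewrite (nneseries_split 0 1); last by move=> k _; rewrite lee_fin poi_ge0.
  rewrite big_nat1 poi0/= eseries0 ?adde0// => i i1 _.
  by rewrite poi0; case: i i1.
rewrite nneseries_esumT; last by move=> *; rewrite lee_fin poi_ge0// ltW.
have := @probability_setT _ _ _ (@poisson_prob R a 0%N); rewrite /= /poisson_prob a0.
by under eq_esum do rewrite poisson_pmfE//.
Qed.

(** The binomial formula for [(a + b) ^+ n], with its coefficients written as quotients of
    factorials. *)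
Lemma poi_add a b n :
  poi (a + b) n = \sum_(i < n.+1) poi a i * poi b (n - i)%N.
Proof.
rewrite /poi opprD expRD addrC exprDn mulr_suml mulr_suml.
apply: eq_bigr => i _.
have ni : (i <= n)%N by rewrite -ltnS.
rewrite -[_ *+ 'C(n, i)]mulr_natr.
have /(congr1 (fun m => m%:R : R)) := bin_fact ni; rewrite !natrM => e.
have f0 m : m`!%:R != 0 :> R by rewrite pnatr_eq0 -lt0n fact_gt0.
apply: (mulIf (f0 n)); rewrite -{1}e.
field : e.
by rewrite !f0 pnatr_eq0 -lt0n bin_gt0.
Qed.

(** The truncated subtraction is harmless: the coefficient vanishes when [z] exceeds [k]. *)
Definition binom_weight p k z : R := 'C(k, z)%:R * p ^+ z * (1 - p) ^+ (k - z).

Lemma binom_weight_ge0 p k z : 0 <= p <= 1 -> 0 <= binom_weight p k z.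
Proof.
by move=> /andP[p0 p1]; rewrite !mulr_ge0// exprn_ge0// subr_ge0.
Qed.

Lemma binom_weight0 p z : binom_weight p 0 z = (z == 0%N)%:R.
Proof. by case: z => [|z]; rewrite /binom_weight ?bin0n ?mulr1// !mul0r. Qed.

Lemma binom_weightS0 p k : binom_weight p k.+1 0 = binom_weight p k 0 * (1 - p).
Proof. by rewrite /binom_weight !bin0 !subn0 !mul1r exprSr. Qed.

Lemma binom_weightSS p k z :
  binom_weight p k.+1 z.+1 =
  binom_weight p k z.+1 * (1 - p) + binom_weight p k z * p.
Proof.
rewrite /binom_weight binS subSS natrD.
have [zk|kz] := ltnP z k.
  rewrite -(subnSK zk) !exprSr; ring.
by rewrite (bin_small (_ : k < z.+1)%N)// !mul0r !add0r exprSr; ring.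
Qed.

(** Poisson thinning. The terms with [k < z] vanish; the term of index [k + z] factors into the
    weight of [z] kept points and the weight of [k] discarded points, and the latter weights sum to
    1. *)
Lemma poi_thin a p z : 0 <= a -> 0 <= p <= 1 ->
  (\sum_(0 <= k <oo) (poi a k * binom_weight p k z)%:E = (poi (a * p) z)%:E)%E.
Proof.
move=> a0 p01; have /andP[p0 p1] := p01.
have q0 : 0 <= a * (1 - p) by rewrite mulr_ge0// subr_ge0.
rewrite (nneseries_split 0 z); last first.
  by move=> k _; rewrite lee_fin mulr_ge0 ?poi_ge0 ?binom_weight_ge0.
rewrite add0n big_nat big1 ?add0e; last first.
  by move=> i /andP[_ iz]; rewrite /binom_weight bin_small// !mul0r mulr0.
rewrite -nneseries_addn; last first.
  by move=> k; rewrite lee_fin mulr_ge0 ?poi_ge0 ?binom_weight_ge0.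
under eq_eseriesr => k _.
  have -> : (poi a (k + z) * binom_weight p (k + z) z)%:E =
      ((poi (a * p) z)%:E * (poi (a * (1 - p)) k)%:E)%E.
    rewrite -EFinM; congr EFin; rewrite /poi /binom_weight addnK.
    have /(congr1 (fun m => m%:R : R)) := bin_fact (leq_addl k z).
    rewrite addnK !natrM => e.
    have f0 m : m`!%:R != 0 :> R by rewrite pnatr_eq0 -lt0n fact_gt0.
    rewrite [in LHS](_ : - a = - (a * p) + - (a * (1 - p))); last by ring.
    rewrite expRD -e !exprMn exprD.
    by field; rewrite !f0 pnatr_eq0 -lt0n bin_gt0 leq_addl.
  over.
rewrite nneseriesZl/=; last by move=> i _; rewrite lee_fin poi_ge0.
by rewrite poi_sum// mule1.
Qed.

(** The right-hand side is [(1 + a) * expR (- a)], and [expR (- a)] is at least [1 - a]. This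
    controls the probability of two arrivals in a short interval. *)
Lemma poi_sum2_ge a : 0 <= a -> 1 - a ^+ 2 <= poi a 0 + poi a 1.
Proof.
move=> a0; rewrite [leRHS](_ : _ = (1 + a) * expR (- a)); last first.
  by rewrite /poi expr0 expr1 !divr1 mul1r mulrDl mul1r.
apply: (@le_trans _ _ ((1 + a) * (1 - a))).
  by rewrite le_eqVlt; apply/orP; left; apply/eqP; ring.
rewrite ler_wpM2l ?addr_ge0//.
exact: expR_ge1Dx.
Qed.

End poisson_weights.

(** * The counting measure on the naturals *)

Section counting_facts.
Context {R : realType}.
Implicit Types X Y : set nat.

Lemma counting_natVy X :
  counting X = +oo%E :> \bar R \/ exists n, counting X = n%:R%:E :> \bar R.
Proof. by rewrite /counting; case: ifPn => _; [right; eexists|left]. Qed.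

Lemma le_counting X Y : X `<=` Y -> (counting X <= counting Y :> \bar R)%E.
Proof. by move=> XY; apply: le_measure => //; rewrite inE. Qed.

Lemma counting_bound k (b : nat -> bool) :
  counting [set n | (n < k)%N /\ b n] = (\sum_(i < k) b i)%N%:R%:E :> \bar R.
Proof.
elim: k => [|k IH].
  by rewrite (_ : [set n | _] = set0) ?measure0 ?big_ord0// -subset0 => n [].
rewrite (_ : [set n | _] = [set n | (n < k)%N /\ b n] `|` [set n | n = k /\ b k]); last first.
  apply/seteqP; split => [n /= [+ bn]|n /= [[nk bn]|[-> bk]]].
  - rewrite ltnS leq_eqVlt => /orP[/eqP nk|nk]; last by left.
    by right; rewrite -nk.
  - by rewrite ltnS ltnW.
  - by rewrite ltnS leqnn.
rewrite measureU//; last first.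
  by rewrite -subset0 => n [] /= [nk _] [nk' _]; rewrite nk' ltnn in nk.
rewrite [X in (X + _)%E]IH big_ord_recr/= natrD EFinD; congr (_ + _)%E.
have [bk|/negPf bk] := boolP (b k).
  rewrite (_ : [set n | _] = [set k]); last by apply/seteqP; split => n /=; [case|].
  by rewrite /counting asboolT ?fset_set1 ?finmap.cardfs1.
by rewrite (_ : [set n | _ /\ false] = set0) ?measure0// -subset0 => n [].
Qed.

(** The count is the sum of the indicators of the [E n]. *)
Lemma measurable_counting d (T : measurableType d) (E : nat -> set T) :
  (forall n, measurable (E n)) ->
  measurable_fun setT (fun w => counting [set n | E n w] : \bar R).
Proof.
move=> mE.
rewrite (_ : (fun w => _) = (fun w => \sum_(0 <= n <oo) (\1_(E n) w)%:E)%E).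
  apply: ge0_emeasurable_sum => [n x _ _|n _]; first by rewrite lee_fin.
  by apply/measurable_EFinP/measurable_indicP.
apply/funext => w; rewrite counting_dirac; apply: eq_eseriesr => n _.
rewrite /dirac/= !indicE; congr (_%:R%:E); congr nat_of_bool.
Qed.

End counting_facts.

(** * Independence on generated sigma-algebras and total probability *)

Section probability_facts.
Local Open Scope ereal_scope.
Context d (T : measurableType d) (R : realType) (P : probability T R).

(** Both sides are finite measures in [X]; they agree on the pi-system [G], hence on the
    sigma-algebra that it generates. *)
Lemma g_sigma_indep (G : set_system T) (H : set T) (q : R) : (0 <= q)%R ->
  G `<=` measurable -> setI_closed G -> G setT -> measurable H ->
  (forall X, G X -> P (X `&` H) = P X * q%:E) ->
  forall X, <<s G >> X -> P (X `&` H) = P X * q%:E.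
Proof.
move=> q0 Gm GI GT mH PG X GX.
transitivity (mscale (NngNum q0) P X); last by rewrite /mscale/= muleC.
apply: (@g_sigma_algebra_measure_unique _ R _ G Gm (fun=> setT) (fun=> GT) _
  (mrestr P mH) (mscale (NngNum q0) P) GI) => //.
- by rewrite bigcup_const//; exists 0%N.
- by move=> Y GY; rewrite /= /mrestr /mscale/= PG// muleC.
- move=> _; rewrite /= /mrestr setTI; apply: le_lt_trans (probability_le1 P mH) _.
  exact: ltry.
Qed.

(** The [D k] are disjoint and their probabilities add up to 1, so that they cover the space up to a
    null set. *)
Lemma total_prob (D : (set T)^nat) : (forall k, measurable (D k)) ->
  trivIset setT D -> \sum_(0 <= k <oo) P (D k) = 1 ->
  forall X, measurable X -> P X = \sum_(0 <= k <oo) P (X `&` D k).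
Proof.
move=> mD tD D1 X mX.
have mU : measurable (\bigcup_k D k) by exact: bigcupT_measurable.
have PU : P (\bigcup_k D k) = 1.
  by rewrite measure_bigcup// -D1; apply: eq_eseriesl => k; rewrite in_setT.
have PC : P (~` \bigcup_k D k) = 0 by rewrite probability_setC// PU subee.
rewrite -[in LHS](setIT X) -(setUv (\bigcup_k D k)) setIUr measureU; first last.
- by rewrite setIACA setICr setI0.
- by apply: measurableI => //; exact: measurableC.
- exact: measurableI.
rewrite [X in _ + X](@subset_measure0 _ _ _ P _ (~` \bigcup_k D k)) ?adde0//; first last.
- exact: measurableC.
- by apply: measurableI => //; exact: measurableC.
rewrite setI_bigcupr; transitivity (\sum_(k <oo | k \in [set: nat]) P (X `&` D k)).
  apply: (@measure_bigcup _ _ _ P setT (fun k => X `&` D k)) => //.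
  - by move=> k _; exact: measurableI.
  - exact: trivIset_setIl.
by apply: eq_eseriesl => k; rewrite in_setT.
Qed.

End probability_facts.

(** * Set operations inside a generated sigma-algebra *)

Section g_sigma_operations.
Context {T : pointedType} (G : set_system T).

Lemma g_sigma0 : <<s G >> set0.
Proof. exact: (@measurable0 _ (g_sigma_algebraType G)). Qed.

Lemma g_sigmaT : <<s G >> setT.
Proof. exact: (@measurableT _ (g_sigma_algebraType G)). Qed.

Lemma g_sigmaC X : <<s G >> X -> <<s G >> (~` X).
Proof. exact: (@measurableC _ (g_sigma_algebraType G)). Qed.

Lemma g_sigmaI X Y : <<s G >> X -> <<s G >> Y -> <<s G >> (X `&` Y).
Proof. exact: (@measurableI _ (g_sigma_algebraType G)). Qed.

Lemma g_sigmaU X Y : <<s G >> X -> <<s G >> Y -> <<s G >> (X `|` Y).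
Proof. exact: (@measurableU _ (g_sigma_algebraType G)). Qed.

Lemma g_sigmaD X Y : <<s G >> X -> <<s G >> Y -> <<s G >> (X `\` Y).
Proof. exact: (@measurableD _ (g_sigma_algebraType G)). Qed.

End g_sigma_operations.

(** * Marked customers in unit cells *)

Section queue_law.
Context d (T : measurableType d) (R : realType) (P : probability T R).
Context (lambda : R) (S : {RV P >-> R}) (A V : nat -> {RV P >-> R}).
Hypothesis lambda_gt0 : 0 < lambda.
Hypothesis queue : MGinfty_queue lambda S A V.

Let arrivals : poisson_process lambda A := queue_arrivals queue.

Lemma arrival_mono w m n : (m <= n)%N -> A m w <= A n w.
Proof.
move=> mn; elim: n mn => [|n IH]; first by rewrite leqn0 => /eqP->.
rewrite leq_eqVlt => /predU1P[->//|/IH /le_trans -> //].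
exact: poisson_nondecreasing arrivals n w.
Qed.

Lemma arrival_gt0 w n : 0 < A n w.
Proof. exact: lt_le_trans (poisson_gt0 arrivals w) (arrival_mono w (leq0n n)). Qed.

(** As arrival times are nondecreasing, this is the event of exactly [K] arrivals by time [t]. The
    form by indices also tells which customers these are. *)
Definition upto (t : R) (K : nat) : set T :=
  [set w | forall n, (A n w <= t) = (n < K)%N].

Lemma arrivals_dichotomy (t : R) (w : T) :
  (forall n, A n w <= t) \/ exists K, upto t K w.
Proof.
have [h|] := pselect (forall n, A n w <= t); first by left.
move=> /existsNP ex; right.
have ex' : exists n, ~~ (A n w <= t) by case: ex => n /negP; exists n.
exists (ex_minn ex'); case: ex_minnP => m mt mmin n.
apply/idP/idP => [nt|nm]; last by apply: contraTT nm => /mmin; rewrite -leqNgt.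
rewrite ltnNge; apply: contra mt => mn; exact: le_trans (arrival_mono w mn) nt.
Qed.

Lemma counting_setT : counting [set: nat] = +oo%E :> \bar R.
Proof. by rewrite /counting asboolF//; exact: infinite_nat. Qed.

Lemma counting_lt K : counting [set n | (n < K)%N] = K%:R%:E :> \bar R.
Proof.
rewrite (_ : [set n | _] = [set n | (n < K)%N /\ true]).
  rewrite (counting_bound (R := R) K (fun=> true)).
  by rewrite sum1_card card_ord.
by apply/seteqP; split => n //= -[].
Qed.

Lemma arrivals_upto (t : R) K w : upto t K w -> arrivals_in A 0 t w = K%:R%:E.
Proof.
move=> tK; rewrite /arrivals_in -counting_lt; congr counting.
by apply/seteqP; split => n /=; rewrite arrival_gt0 tK.
Qed.

Lemma arrivals_infinite (t : R) w : (forall n, A n w <= t) ->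
  arrivals_in A 0 t w = +oo%E.
Proof.
move=> h; rewrite /arrivals_in -counting_setT; congr counting.
by apply/seteqP; split => n //= _; rewrite arrival_gt0 h.
Qed.

Lemma uptoE (t : R) K : upto t K = [set w | arrivals_in A 0 t w = K%:R%:E].
Proof.
apply/seteqP; split => w /=; first exact: arrivals_upto.
have [/arrivals_infinite->//|[M tM]] := arrivals_dichotomy t w.
by rewrite (arrivals_upto tM) => -[/eqP]; rewrite eqr_nat => /eqP <-.
Qed.

(** Translates arrival times into counts, so that events about arrivals at lattice times are
    expressed by the increments over the cells. *)
Lemma arrivals_ge (t : R) n w :
  (A n w <= t) = (n.+1%:R%:E <= arrivals_in A 0 t w)%E.
Proof.
have [h|[M tM]] := arrivals_dichotomy t w.
  by rewrite arrivals_infinite// leey h.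
by rewrite (arrivals_upto tM) lee_fin ler_nat tM.
Qed.

Definition incr (i : nat) : T -> \bar R := arrivals_in A i%:R i.+1%:R.

Lemma arrivals_add (r s t : R) w : r <= s -> s <= t ->
  arrivals_in A r t w = (arrivals_in A r s w + arrivals_in A s t w)%E.
Proof.
move=> rs st; rewrite /arrivals_in -measureU//.
- congr counting; apply/seteqP; split => n /=; last first.
    move=> [/andP[-> /le_trans ->]//|/andP[h ->]].
    by rewrite (le_lt_trans rs h).
  move=> /andP[rA At]; have [As|sA] := leP (A n w) s; first by left; rewrite rA.
  by right.
- rewrite -subset0 => n /= [/andP[_ As] /andP[sA _]].
  by move: (lt_le_trans sA As); rewrite ltxx.
Qed.

Lemma arrivals_sum (l : nat) w :
  arrivals_in A 0 l%:R w = (\sum_(i < l) incr i w)%E.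
Proof.
elim: l => [|l IH]; last first.
  by rewrite big_ord_recr/= -IH -arrivals_add// ler_nat.
rewrite big_ord0 /arrivals_in (_ : [set n | _] = set0) ?measure0//.
rewrite -subset0 => n /= /andP[h1 h2].
by move: (lt_le_trans h1 h2); rewrite ltxx.
Qed.

(** The space is arbitrary because the lemma also serves for the sigma-algebra generated by the
    arrival times. *)
Lemma measurable_arrivals d' (T' : measurableType d') (A' : nat -> T' -> R) (s t : R) :
  (forall n, measurable_fun setT (A' n)) -> measurable_fun setT (arrivals_in A' s t).
Proof.
move=> mA; rewrite /arrivals_in.
apply: (@measurable_counting R _ T' (fun n => [set w | s < A' n w <= t])) => n.
rewrite (_ : [set w | _] = A' n @^-1` `]s, t]); last first.
  by apply/seteqP; split => w /=; rewrite in_itv.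
by rewrite -[_ @^-1` _]setTI; exact: mA.
Qed.

Definition genA : set_system T :=
  [set E | exists (n : nat) (B : set R), measurable B /\ E = A n @^-1` B].

Lemma genA_fun n : measurable_fun setT (A n : g_sigma_algebraType genA -> R).
Proof.
by move=> _ B mB; rewrite setTI; apply: sub_sigma_algebra; exists n, B.
Qed.

Lemma genA_arrivals (s t : R) :
  measurable_fun setT (arrivals_in A s t : g_sigma_algebraType genA -> \bar R).
Proof. apply: measurable_arrivals => n; exact: genA_fun. Qed.

Lemma measurable_arrivals_in (s t : R) : measurable_fun setT (arrivals_in A s t).
Proof. exact: measurable_arrivals. Qed.

Lemma measurable_arrivals_eq (s t : R) x : measurable [set w | arrivals_in A s t w = x].
Proof.
rewrite (_ : [set w | _] = setT `&` arrivals_in A s t @^-1` [set x]); last by rewrite setTI.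
exact: measurable_arrivals_in.
Qed.

Lemma measurable_arrival_le n (t : R) : measurable [set w | A n w <= t].
Proof.
rewrite (_ : [set w | _] = setT `&` A n @^-1` `]-oo, t]); first exact: measurable_funPT.
by rewrite setTI; apply/seteqP; split => w /=; rewrite in_itv.
Qed.

(** * Pi-systems of events on arrivals and service times *)

Definition rectV K (B : nat -> set R) : set T := \bigcap_(i in `I_K) V i @^-1` B i.

(** Generators for the information carried by the first [l] cell counts and the first [K] service
    times. *)
Definition pastG (l K : nat) : set_system T :=
  [set X | exists (C : nat -> set (\bar R)) (B : nat -> set R),
    [/\ forall i, measurable (C i), forall i, measurable (B i) &
     X = (\bigcap_(i in `I_l) incr i @^-1` C i) `&` rectV K B]].

(** Here [G] may depend on all arrivals, future ones included: service time [n] is independent even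
    of these, which lets customers be marked after the arrivals have been fixed. *)
Definition allG (n : nat) : set_system T :=
  [set X | exists (G : set T) (B : nat -> set R),
    [/\ sigma_generated A G, forall i, measurable (B i) & X = G `&` rectV n B]].

Lemma rectVI K B B' : rectV K B `&` rectV K B' = rectV K (fun i => B i `&` B' i).
Proof. by rewrite /rectV -bigcapI. Qed.

Lemma rectVT K : rectV K (fun=> setT) = setT.
Proof. by apply/seteqP; split => // w _ i _. Qed.

Lemma rectVS K B : rectV K.+1 B = rectV K B `&` V K @^-1` B K.
Proof.
apply/seteqP; split=> [w h|w [h hK] i].
  by split => [i /= iK|]; apply: h => //=; exact: ltnW.
rewrite /= ltnS leq_eqVlt => /predU1P[->//|]; exact: h.
Qed.

Lemma measurable_rectV K B : (forall i, measurable (B i)) -> measurable (rectV K B).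
Proof.
move=> mB; apply: bigcap_measurableType => i _.
by rewrite -[_ @^-1` _]setTI; exact: measurable_funPT.
Qed.

Lemma rectV_generated K B : (forall i, measurable (B i)) -> sigma_generated V (rectV K B).
Proof.
move=> mB; apply: (@bigcap_measurableType _ (g_sigma_algebraType _)) => i _.
by apply: sub_sigma_algebra; exists i, (B i).
Qed.

Lemma sigma_generated_sub (X : nat -> {RV P >-> R}) : sigma_generated X `<=` measurable.
Proof.
apply: smallest_sub; first exact: sigma_algebra_measurable.
by move=> _ [n [B [mB ->]]]; rewrite -[_ @^-1` _]setTI; exact: measurable_funPT.
Qed.

Lemma rect_incr_generated l C : (forall i, measurable (C i)) ->
  sigma_generated A (\bigcap_(i in `I_l) incr i @^-1` C i).
Proof.
move=> mC; apply: (@bigcap_measurableType _ (g_sigma_algebraType _)) => i _.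
rewrite -[_ @^-1` _]setTI.
exact: (genA_arrivals i%:R i.+1%:R).
Qed.

Lemma rect_indep G K B : sigma_generated A G -> (forall i, measurable (B i)) ->
  P (G `&` rectV K B) = (P G * P (rectV K B))%E.
Proof.
by move=> gG mB; apply: (queue_arrival_service_independent queue) => //; exact: rectV_generated.
Qed.

Lemma allG_measurable n : allG n `<=` measurable.
Proof.
move=> _ [G [B [gG mB ->]]]; apply: measurableI; last exact: measurable_rectV.
exact: sigma_generated_sub gG.
Qed.

Lemma allG_setI n : setI_closed (allG n).
Proof.
move=> _ _ [G [B [gG mB ->]]] [G' [B' [gG' mB' ->]]].
exists (G `&` G'), (fun i => B i `&` B' i); split.
- exact: g_sigmaI.
- by move=> i; exact: measurableI.
- by rewrite setIACA rectVI.
Qed.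

Lemma allG_setT n : allG n setT.
Proof.
exists setT, (fun=> setT); split => //; last by rewrite rectVT setIT.
exact: g_sigmaT.
Qed.

Lemma pastG_allG l K : pastG l K `<=` allG K.
Proof.
move=> _ [C [B [mC mB ->]]].
by exists (\bigcap_(i in `I_l) incr i @^-1` C i), B; split => //; exact: rect_incr_generated.
Qed.

Lemma pastG_measurable l K : pastG l K `<=` measurable.
Proof. by move=> X /pastG_allG; exact: allG_measurable. Qed.

Lemma pastG_setI l K : setI_closed (pastG l K).
Proof.
move=> _ _ [C [B [mC mB ->]]] [C' [B' [mC' mB' ->]]].
exists (fun i => C i `&` C' i), (fun i => B i `&` B' i); split.
- by move=> i; exact: measurableI.
- by move=> i; exact: measurableI.
- by rewrite setIACA rectVI -bigcapI.
Qed.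

Lemma pastG_setT l K : pastG l K setT.
Proof.
exists (fun=> setT), (fun=> setT); split => //; rewrite rectVT setIT.
by apply/seteqP; split => // w _ i _.
Qed.

Lemma past_sub l K : <<s pastG l K >> `<=` <<s allG K >>.
Proof. apply: sub_sigma_algebra2; exact: pastG_allG. Qed.

Lemma all_sub n : <<s allG n >> `<=` measurable.
Proof.
apply: smallest_sub; first exact: sigma_algebra_measurable.
exact: allG_measurable.
Qed.

Lemma allG_mono m n : (m <= n)%N -> <<s allG m >> `<=` <<s allG n >>.
Proof.
move=> mn; apply: sub_sigma_algebra2 => _ [G [B [gG mB ->]]].
exists G, (fun i => if (i < m)%N then B i else setT); split => //.
  by move=> i; case: ifP.
congr (_ `&` _); apply/seteqP; split => w h i /= im.
  by case: ifP => // ?; exact: h.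
by have := h i (leq_trans im mn); rewrite /= im.
Qed.

Definition tail (c : R) : R := fine (P [set w | c <= S w]).

Lemma measurable_tail (X : {RV P >-> R}) c : measurable [set w | c <= X w].
Proof.
rewrite (_ : [set w | _] = setT `&` X @^-1` `[c, +oo[).
  exact: measurable_funPT.
by rewrite setTI; apply/seteqP; split => w /=; rewrite in_itv/= andbT.
Qed.

Lemma tailE c : (tail c)%:E = P [set w | c <= S w].
Proof. by rewrite fineK// fin_num_measure//; exact: measurable_tail. Qed.

Lemma tail01 c : 0 <= tail c <= 1.
Proof.
rewrite -!lee_fin tailE measure_ge0/= probability_le1//; exact: measurable_tail.
Qed.

Lemma service_prob n (B : set R) : measurable B -> P (V n @^-1` B) = P (S @^-1` B).
Proof. exact: (queue_service_law queue n (B := B)). Qed.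

Lemma service_tail n c : P [set w | c <= V n w] = (tail c)%:E.
Proof.
rewrite tailE.
have e (X : T -> R) : [set w | c <= X w] = X @^-1` `[c, +oo[.
  by apply/seteqP; split => w /=; rewrite in_itv/= andbT.
by rewrite !e; exact: (service_prob n (measurable_itv `[c, +oo[)).
Qed.

(** It suffices to treat the generators [allG n]. There [B] becomes side [n] of a longer rectangle
    of service times, and the independence of [V] and of [A] and [V] applies to both rectangles. *)
Lemma service_step n X (B : set R) : <<s allG n >> X -> measurable B ->
  P (X `&` V n @^-1` B) = (P X * P (V n @^-1` B))%E.
Proof.
move=> gX mB.
have mVB : measurable (V n @^-1` B) by rewrite -[_ @^-1` _]setTI; exact: measurable_funPT.
have fVB : P (V n @^-1` B) \is a fin_num by exact: fin_num_measure.
rewrite -(fineK fVB); move: X gX; apply: g_sigma_indep => //.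
- by rewrite fine_ge0.
- exact: allG_measurable.
- exact: allG_setI.
- exact: allG_setT.
move=> _ [G [B' [gG mB' ->]]]; rewrite fineK//.
pose B2 i := if (i < n)%N then B' i else B.
have mB2 i : measurable (B2 i) by rewrite /B2; case: ifP.
have -> : rectV n B' = rectV n B2.
  by apply: eq_bigcapr => i /= ilt; rewrite /B2 ilt.
have {1}-> : B = B2 n by rewrite /B2 ltnn.
rewrite -setIA -rectVS !rect_indep// -muleA; congr (_ * _)%E.
rewrite !(queue_service_independent queue)// big_ord_recr/=.
by rewrite /B2 ltnn.
Qed.

(** On a generator of the past, the condition on cell [l] extends the list of conditions on the
    earlier cells; the increments are independent of each other and of the service times. *)
Lemma arrival_step l K X k : <<s pastG l K >> X ->
  P (X `&` [set w | incr l w = k%:R%:E]) = (P X * (poi lambda k)%:E)%E.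
Proof.
have mk : measurable [set w | incr l w = k%:R%:E] by exact: measurable_arrivals_eq.
have m1 (x : \bar R) : measurable [set x] by exact: emeasurable_set1.
move: X; apply: g_sigma_indep => //.
- exact/poi_ge0/ltW.
- exact: pastG_measurable.
- exact: pastG_setI.
- exact: pastG_setT.
move=> _ [C [B [mC mB ->]]].
pose C2 i := if (i < l)%N then C i else [set k%:R%:E].
have mC2 i : measurable (C2 i) by rewrite /C2; case: ifP.
rewrite setIAC.
have -> : \bigcap_(i in `I_l) incr i @^-1` C i `&` [set w | incr l w = k%:R%:E] =
    \bigcap_(i in `I_l.+1) incr i @^-1` C2 i.
  apply/seteqP; split=> [w [h hK] i|w h].
    rewrite /= ltnS leq_eqVlt => /predU1P[->|il]; first by rewrite /C2 ltnn.
    by rewrite /C2 il; exact: h.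
  split => [i /= il|].
    by have := h i (ltnW il); rewrite /C2 /= il.
  by have := h l (leqnn _); rewrite /C2 /= ltnn.
rewrite !rect_indep//; [|exact: rect_incr_generated|exact: rect_incr_generated].
rewrite muleAC; congr (_ * _)%E.
have nat0 : 0 <= (0%:R : R) by [].
have inc (i : nat) : i%:R <= i.+1%:R :> R by rewrite ler_nat.
have := poisson_independent_increments arrivals nat0 inc.
rewrite -/incr => ind; rewrite !ind// big_ord_recr/=.
congr (_ * _)%E.
  by apply: eq_bigr => i _; rewrite /C2 ltn_ord.
rewrite /C2 ltnn -poisson_pmfE//.
have := @poisson_increment_law _ _ _ _ _ _ arrivals l%:R l.+1%:R k (ler0n _ _).
by rewrite ltr_nat ltnSn -natrB// subSnn mulr1 => ->.
Qed.

(* Once it is known that K customers arrived by time l, E only depends on the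
   numbers of arrivals in the first l cells and on the first K service times. *)
Definition past (l : nat) (E : set T) : Prop :=
  measurable E /\ forall K, <<s pastG l K >> (E `&` upto l%:R K).

Lemma past_incr l K i : (i < l)%N ->
  measurable_fun setT (incr i : g_sigma_algebraType (pastG l K) -> \bar R).
Proof.
move=> il _ C mC; rewrite setTI; apply: sub_sigma_algebra.
exists (fun j => if j == i then C else setT), (fun=> setT); split => //.
  by move=> j; case: ifP.
rewrite rectVT setIT; apply/seteqP; split => [w /= h j _|w h].
  by case: eqP => [->|].
by have := h i il; rewrite eqxx.
Qed.

Lemma past_arrivals l K i : (i <= l)%N ->
  measurable_fun setT
    (arrivals_in A 0 i%:R : g_sigma_algebraType (pastG l K) -> \bar R).
Proof.
move=> il; rewrite (_ : arrivals_in _ _ _ = fun w => (\sum_(j < i) incr j w)%E).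
  by apply: emeasurable_sum => j; apply: past_incr; exact: leq_trans il.
by apply/funext => w; exact: arrivals_sum.
Qed.

Lemma past_upto l K : <<s pastG l K >> (upto l%:R K).
Proof.
rewrite uptoE (_ : [set w | _] = setT `&` arrivals_in A 0 l%:R @^-1` [set K%:R%:E]).
  exact: past_arrivals (leqnn l) measurableT _ (emeasurable_set1 _).
by rewrite setTI.
Qed.

Lemma past_arrival l K i n : (i <= l)%N -> <<s pastG l K >> [set w | A n w <= i%:R].
Proof.
move=> il; rewrite (_ : [set w | _] =
    setT `&` arrivals_in A 0 i%:R @^-1` `[n.+1%:R%:E, +oo%E]).
  exact: past_arrivals il measurableT _ (emeasurable_itv _).
rewrite setTI; apply/seteqP; split => w /=; rewrite in_itv/= arrivals_ge leey andbT//.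
Qed.

Lemma past_service l K n c : (n < K)%N -> <<s pastG l K >> [set w | c <= V n w].
Proof.
move=> nK; apply: sub_sigma_algebra.
exists (fun=> setT), (fun i => if i == n then [set` `[c, +oo[] else setT); split => //.
  by move=> i; case: ifP.
apply/seteqP; split => [w /= h|w /= [_ /(_ n nK)]]; last first.
  by rewrite eqxx /= in_itv/= andbT.
split=> // i _; case: eqP => [->|//].
by rewrite /= in_itv/= h.
Qed.

Lemma pastT l : past l setT.
Proof. by split=> // K; rewrite setTI; exact: past_upto. Qed.

Lemma pastI l E F : past l E -> past l F -> past l (E `&` F).
Proof.
move=> [mE pE] [mF pF]; split; first exact: measurableI.
move=> K; rewrite -(setIid (upto l%:R K)) setIACA.
exact: g_sigmaI.
Qed.

Lemma pastC l E : past l E -> past l (~` E).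
Proof.
move=> [mE pE]; split; first exact: measurableC.
move=> K; rewrite (_ : ~` E `&` upto l%:R K = upto l%:R K `\` (E `&` upto l%:R K)).
  apply: g_sigmaD => //; exact: past_upto.
by apply/seteqP; split=> w /=; tauto.
Qed.

Lemma past_bigcap l (F : nat -> set T) (D : set nat) :
  (forall i, D i -> past l (F i)) -> past l (\bigcap_(i in D) F i).
Proof.
move=> pF; split.
  by apply: bigcap_measurableType => i /pF[].
(* Adding the complement of [upto] to each set leaves the intersection with [upto] unchanged and
   makes each set measurable for the sigma-algebra of [pastG l K]. *)
move=> K; rewrite (_ : _ `&` _ =
    upto l%:R K `&` \bigcap_(i in D) (F i `|` ~` upto l%:R K)).
  apply: g_sigmaI; first exact: past_upto.
  apply: (@bigcap_measurableType _ (g_sigma_algebraType _)) => i /pF[_ /(_ K) pE].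
  rewrite (_ : _ `|` _ = (F i `&` upto l%:R K) `|` ~` upto l%:R K).
    apply: g_sigmaU => //.
    apply: g_sigmaC; exact: past_upto.
  by rewrite setUIl setUv setIT.
apply/seteqP; split => [w [h u]|w [u h]]; split => // i Di.
  by left; exact: h.
by have [|//] := h i Di.
Qed.

Lemma pastG_mono l l' K K' : (l <= l')%N -> (K <= K')%N ->
  <<s pastG l K >> `<=` <<s pastG l' K' >>.
Proof.
move=> ll KK; apply: sub_sigma_algebra2 => _ [C [B [mC mB ->]]].
exists (fun i => if (i < l)%N then C i else setT),
  (fun i => if (i < K)%N then B i else setT); split.
- by move=> i; case: ifP.
- by move=> i; case: ifP.
apply/seteqP; split => [w [hC hB]|w [hC hB]]; split => i /= ilt.
- by case: ifP => // ?; exact: hC.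
- by case: ifP => // ?; exact: hB.
- by have := hC i (leq_trans ilt ll); rewrite /= ilt.
- by have := hB i (leq_trans ilt KK); rewrite /= ilt.
Qed.

(** If [K'] customers arrived by the later time, the number [K] of arrivals by the earlier time is
    at most [K']. Splitting along [K] leaves events about at most [K'] service times. *)
Lemma past_mono l l' E : (l <= l')%N -> past l E -> past l' E.
Proof.
move=> ll [mE gE]; split => // K'.
rewrite (_ : _ `&` _ = \bigcup_(K in [set K | (K <= K')%N])
    ((E `&` upto l%:R K) `&` upto l'%:R K')).
  apply: (@bigcup_measurable _ (g_sigma_algebraType (pastG l' K'))) => K /= KK.
  apply: (@g_sigmaI _ (pastG l' K')); last exact: past_upto.
  by apply: pastG_mono ll KK _ _; exact: gE.
apply/seteqP; split => [w [Ew lK']|w [K _ [[]]]//].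
have [h|[K lK]] := arrivals_dichotomy l%:R w.
  have := lK' K'; rewrite ltnn => /negP; case.
  by rewrite (le_trans (h K'))// ler_nat.
exists K => //=; rewrite leqNgt; apply/negP => KK.
have := lK' K'; rewrite ltnn => /negP; case.
by rewrite (@le_trans _ _ l%:R) ?ler_nat// lK.
Qed.

(** * Counts of marked customers and their Poisson law *)

Definition present (Q : nat -> R) (a b n : nat) : set T :=
  [set w | exists i, [/\ (a <= i < b)%N, i%:R < A n w <= i.+1%:R & Q i <= V n w]].

(** The threshold [Q i] depends on the arrival cell and not on the exact arrival time, so that the
    marks in one cell are independent trials with a common success probability. *)
Definition cnt (Q : nat -> R) (a b : nat) (w : T) : \bar R :=
  counting [set n | present Q a b n w].

Lemma present_measurable G Q a b n :
  (forall i, (i <= b)%N -> <<s G >> [set w | A n w <= i%:R]) ->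
  (forall c, <<s G >> [set w | c <= V n w]) ->
  <<s G >> (present Q a b n).
Proof.
move=> mA mV; rewrite (_ : present Q a b n = \bigcup_(i in [set i | (a <= i < b)%N])
    (([set w | A n w <= i.+1%:R] `\` [set w | A n w <= i%:R]) `&` [set w | Q i <= V n w])).
  apply: (@bigcup_measurable _ (g_sigma_algebraType _)) => i /= /andP[ai ib].
  apply: (@g_sigmaI _ G); last exact: mV.
  by apply: g_sigmaD; apply: mA => //; exact: ltnW.
apply/seteqP; split => [w [i [ib /andP[iA Ai] QV]]|w [i /= ib [[Ai /negP iA] QV]]].
  by exists i => //; split => //; split => //=; apply/negP; rewrite -ltNge.
by exists i; split => //; rewrite Ai ltNge iA.
Qed.

Lemma measurable_cnt Q a b : measurable_fun setT (cnt Q a b).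
Proof.
apply: (@measurable_counting R _ T (present Q a b)) => n.
(* The full sigma-algebra is written as generated by itself, the form in which [present_measurable]
   applies. *)
have -> : @measurable _ T = <<s @measurable _ T >>.
  by rewrite smallest_id//; exact: sigma_algebra_measurable.
apply: present_measurable => [i _|c]; apply: sub_sigma_algebra.
  exact: measurable_arrival_le.
exact: measurable_tail.
Qed.

Lemma measurable_cnt_eq Q a b x : measurable [set w | cnt Q a b w = x].
Proof.
rewrite (_ : [set w | _] = setT `&` cnt Q a b @^-1` [set x]); last by rewrite setTI.
exact: measurable_cnt.
Qed.

(** On [upto l%:R K] only customers of index below [K] can have arrived in a cell before [l];
    dropping the others gives a count that involves [K] service times. *)
Lemma cnt_past Q a b l x : (b <= l)%N -> past l [set w | cnt Q a b w = x].
Proof.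
move=> bl; split; first exact: measurable_cnt_eq.
move=> K; pose E n := if (n < K)%N then present Q a b n else set0.
rewrite (_ : _ `&` _ = [set w | counting [set n | E n w] = x] `&` upto l%:R K).
  apply: g_sigmaI; last exact: past_upto.
  rewrite (_ : [set w | _] = setT `&`
     (fun w => counting [set n | E n w] : \bar R) @^-1` [set x]); last by rewrite setTI.
  apply: (@measurable_counting R _ (g_sigma_algebraType (pastG l K)) E) => // n.
  rewrite /E; case: ifPn => nK; last exact: g_sigma0.
  apply: present_measurable => [i ib|c]; last exact: past_service.
  by apply: past_arrival; exact: leq_trans bl.
have e w : upto l%:R K w -> [set n | present Q a b n w] = [set n | E n w].
  move=> lK; apply/seteqP; split => n /=; rewrite /E; last by case: ifP.
  move=> h; case: ifPn => // /negP; apply.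
  case: h => i [/andP[_ ib] /andP[_ Ai] _]; rewrite -lK (le_trans Ai)// ler_nat.
  exact: leq_trans ib bl.
by apply/seteqP; split => w /= [h lK]; split => //; move: h; rewrite /cnt (e w lK).
Qed.

(** To be used with [K] arrivals before a cell and [k] arrivals inside it. *)
Definition marks (c : R) (K k : nat) (w : T) : nat := (\sum_(i < k) (c <= V (K + i) w)%R)%N.

(** Successive independent trials give a binomial law. The membership in the sigma-algebra is part
    of the induction because [service_step] requires it for the next customer. *)
Lemma marks_step c K X : <<s allG K >> X -> forall k z,
  <<s allG (K + k) >> (X `&` [set w | marks c K k w = z]) /\
  P (X `&` [set w | marks c K k w = z]) = (P X * (binom_weight (tail c) k z)%:E)%E.
Proof.
move=> gX; have mX := all_sub gX; elim=> [|k IH] z.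
  rewrite addn0 binom_weight0 /marks; case: z => [|z] /=.
    rewrite (_ : [set w | _] = setT) ?setIT ?mule1//.
    by apply/seteqP; split => w //= _; rewrite big_ord0.
  rewrite (_ : [set w | _] = set0); last first.
    by rewrite -subset0 => w /=; rewrite big_ord0.
  rewrite setI0 measure0 mule0; split => //.
  exact: g_sigma0.
pose n := (K + k)%N.
pose B := [set` `[c, +oo[].
have mB : measurable B by exact: measurable_itv.
have mCB : measurable (~` B) by exact: measurableC.
have VB w : B (V n w) = (c <= V n w) by rewrite /B/= in_itv/= andbT.
have PB : P (V n @^-1` B) = (tail c)%:E.
  by rewrite -(service_tail n c); congr (P _); apply/seteqP; split => w /=; rewrite VB.
have mVB : measurable (V n @^-1` B) by rewrite -[_ @^-1` _]setTI; exact: measurable_funPT.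
have PCB : P (V n @^-1` (~` B)) = (1 - tail c)%:E.
  by rewrite preimage_setC probability_setC// PB.
have gVB (B' : set R) : measurable B' -> <<s allG (K + k.+1) >> (V n @^-1` B').
  move=> mB'; apply: sub_sigma_algebra.
  exists setT, (fun i => if i == n then B' else setT); split.
  - exact: g_sigmaT.
  - by move=> i; case: ifP.
  rewrite setTI; apply/seteqP; split => [w /= h i _|w h]; first by case: eqP => [->|].
  by have := h n; rewrite /= eqxx; apply; rewrite /n addnS.
have mark w z' : (marks c K k.+1 w = z') <->
    (marks c K k w + (c <= V n w)%R)%N = z' by rewrite /marks big_ord_recr.
have mono : <<s allG (K + k) >> `<=` <<s allG (K + k.+1) >>.
  by apply: allG_mono; rewrite leq_add2l.
(* The recursion of the binomial weights: the last customer either is unmarked, or adds one to the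
   earlier marks. *)
case: z => [|z].
  have -> : X `&` [set w | marks c K k.+1 w = 0%N] =
      (X `&` [set w | marks c K k w = 0%N]) `&` V n @^-1` (~` B).
    apply/seteqP; split => [w [Xw /mark h]|w [[Xw /= h] /= nB]].
      split; last by rewrite /= VB => cV; rewrite cV addn1 in h.
      by split => //=; move: h => /eqP; rewrite addn_eq0 => /andP[/eqP].
    by split => //; apply/mark; rewrite h; move: nB; rewrite VB; case: (c <= _).
  split.
    apply: g_sigmaI; last exact: gVB.
    by apply: mono; exact: (IH 0%N).1.
  rewrite service_step//; last exact: (IH 0%N).1.
  by rewrite (IH 0%N).2 PCB binom_weightS0 [in RHS]EFinM muleA.
have -> : X `&` [set w | marks c K k.+1 w = z.+1] =
    ((X `&` [set w | marks c K k w = z.+1]) `&` V n @^-1` (~` B)) `|`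
    ((X `&` [set w | marks c K k w = z]) `&` V n @^-1` B).
  apply/seteqP; split => [w [Xw /mark h]|w].
    have [cV|/negP cV] := boolP (c <= V n w); [right|left]; split => //=; rewrite ?VB//.
      by split => //=; move: h; rewrite cV addn1 => -[].
    by split => //=; move: h; rewrite (negPf (introN idP cV)) addn0.
  move=> [[[Xw /= h]]|[[Xw /= h]]] /=; rewrite VB => cV; split => //; apply/mark; rewrite h.
    by move/negP/negPf: cV => ->; rewrite addn0.
  by rewrite cV addn1.
have gX1 : <<s allG n >> (X `&` [set w | marks c K k w = z.+1]) by exact: (IH z.+1).1.
have gX0 : <<s allG n >> (X `&` [set w | marks c K k w = z]) by exact: (IH z).1.
split.
  by apply: g_sigmaU => //;
    apply: g_sigmaI; [exact: mono|exact: gVB..|exact: mono|exact: gVB].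
rewrite measureU; first last.
- by rewrite -subset0 => w [[_ /=] + [_ /=]].
- by apply: measurableI => //; exact: all_sub gX0.
- apply: measurableI; first exact: all_sub gX1.
  by rewrite preimage_setC; exact: measurableC.
transitivity (P (X `&` [set w | marks c K k w = z.+1]) * P (V n @^-1` (~` B)) +
    P (X `&` [set w | marks c K k w = z]) * P (V n @^-1` B))%E.
  congr (_ + _)%E; [exact: service_step gX1 mCB|exact: service_step gX0 mB].
rewrite (IH z.+1).2 (IH z).2 PB PCB.
rewrite -!muleA -!EFinM -muleDr//; first by rewrite -EFinD -binom_weightSS.
by rewrite fin_num_measure.
Qed.

Lemma upto_prob l K : P (upto l%:R K) = (poi (lambda * l%:R) K)%:E.
Proof.
case: l => [|l]; last first.
  rewrite uptoE -poisson_pmfE ?mulr_gt0//.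
  have := @poisson_increment_law _ _ _ _ _ _ arrivals 0 l.+1%:R K (lexx _).
  by rewrite subr0 ltr0n => ->.
(* The law of the increments concerns intervals of positive length. At time 0 nobody has arrived,
   since arrival times are positive. *)
rewrite mulr0 poi0.
have u0 w : upto 0%:R 0 w by move=> n; rewrite leNgt arrival_gt0.
case: K => [|K].
  by rewrite (_ : upto _ _ = setT) ?probability_setT//; apply/seteqP; split.
rewrite (_ : upto _ _ = set0) ?measure0//.
by rewrite -subset0 => w /(_ 0%N); rewrite u0.
Qed.

Lemma trivIset_upto (t : R) : trivIset setT (upto t).
Proof.
apply/trivIsetP => i j _ _ ij; rewrite -subset0 => w [hi hj].
wlog lt : i j ij hi hj / (i < j)%N => [h|].
  by move: (ij); rewrite neq_ltn => /orP[|/h]; [exact: h|apply; rewrite 1?eq_sym].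
by have := hj i; rewrite hi ltnn lt.
Qed.

Lemma past_total l E : measurable E ->
  P E = (\sum_(0 <= K <oo) P (E `&` upto l%:R K))%E.
Proof.
move=> mE; apply: total_prob => //.
- by move=> K; apply: (@all_sub K); apply: past_sub; exact: past_upto.
- exact: trivIset_upto.
- under eq_eseriesr do rewrite upto_prob.
  by rewrite poi_sum// mulr_ge0// ltW.
Qed.

Lemma incr_prob l k : P [set w | incr l w = k%:R%:E] = (poi lambda k)%:E.
Proof.
have := @arrival_step l 0 setT k (@g_sigmaT T (pastG l 0)).
by rewrite setTI probability_setT mul1e.
Qed.

Lemma incr_all l k K : <<s allG K >> [set w | incr l w = k%:R%:E].
Proof.
apply: sub_sigma_algebra; exists [set w | incr l w = k%:R%:E], (fun=> setT).
split => //; last by rewrite rectVT setIT.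
rewrite (_ : [set w | _] = setT `&` incr l @^-1` [set k%:R%:E]); last by rewrite setTI.
exact: (genA_arrivals l%:R l.+1%:R) measurableT _ (emeasurable_set1 _).
Qed.

Lemma upto_incr l K k w : upto l%:R K w -> incr l w = k%:R%:E ->
  upto l.+1%:R (K + k)%N w.
Proof.
move=> lK lk; rewrite uptoE /= (@arrivals_add 0 l%:R)// ?ler_nat//.
by rewrite (arrivals_upto lK) -/(incr l w) lk natrD.
Qed.

(** The customers arriving in cell [l] are those numbered from [K] to [K + k - 1]. *)
Lemma cnt_marks Q l K k w : upto l%:R K w -> incr l w = k%:R%:E ->
  cnt Q l l.+1 w = (marks (Q l) K k w)%:R%:E.
Proof.
move=> lK lk; have lKk := upto_incr lK lk.
rewrite /cnt (_ : [set n | _] =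
    [set n | (n < K + k)%N /\ (K <= n)%N && (Q l <= V n w)]).
  rewrite (counting_bound _ (fun n => (K <= n)%N && (Q l <= V n w))).
  rewrite big_split_ord/= big1 ?add0n; last by move=> i _; rewrite leqNgt ltn_ord.
  by congr (_%:R%:E); apply: eq_bigr => i _; rewrite leq_addr.
apply/seteqP; split => n /=.
  move=> [i [lil /andP[iA Ai] QV]]; move: lil iA Ai QV.
  rewrite ltnS -eqn_leq => /eqP <- lA Al ->.
  by rewrite -lKk Al andbT leqNgt -lK -ltNge.
rewrite -lKk => -[Al /andP[Kn QV]]; exists l; rewrite leqnn leqnn Al QV; split => //.
by rewrite andbT ltNge lK -leqNgt.
Qed.

(** Split according to the number [K] of arrivals before the cell and the number [k] inside it. The
    latter is Poisson and independent of the past, the marks are then binomial, and [poi_thin] sums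
    over [k]. *)
Lemma cell_law Q l E z : past l E ->
  P (E `&` [set w | cnt Q l l.+1 w = z%:R%:E]) =
  (P E * (poi (lambda * tail (Q l)) z)%:E)%E.
Proof.
move=> pE; have [mE gE] := pE.
have mZ : measurable [set w | cnt Q l l.+1 w = z%:R%:E] by exact: measurable_cnt_eq.
have l0 := ltW lambda_gt0; have /andP[t0 t1] := tail01 (Q l).
rewrite (past_total l); last exact: measurableI.
rewrite [in RHS](past_total l)// muleC -nneseriesZl//.
apply: eq_eseriesr => K _; rewrite setIAC; set X := E `&` upto _ _.
have gX : <<s allG K >> X by apply: past_sub; exact: gE.
have mX := all_sub gX.
rewrite (@total_prob _ _ _ P (fun k => [set w | incr l w = k%:R%:E])); first last.
- exact: measurableI.
- by under eq_eseriesr do rewrite incr_prob; rewrite poi_sum.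
- apply/trivIsetP => i j _ _ /eqP ij; rewrite -subset0 => w /= [-> [/eqP]].
  by rewrite eqr_nat => /eqP.
- by move=> k; apply: (@all_sub 0); exact: incr_all.
rewrite -poi_thin ?tail01//.
have fX : P X \is a fin_num by exact: fin_num_measure.
rewrite -(fineK fX) muleC -nneseriesZl; last first.
  by move=> k _; rewrite lee_fin mulr_ge0 ?poi_ge0 ?binom_weight_ge0 ?tail01.
apply: eq_eseriesr => k _; rewrite fineK//.
have -> : X `&` [set w | cnt Q l l.+1 w = z%:R%:E] `&` [set w | incr l w = k%:R%:E] =
    (X `&` [set w | incr l w = k%:R%:E]) `&` [set w | marks (Q l) K k w = z].
  rewrite setIAC; apply/seteqP; split => w [[[Ew lK] lk] /= h]; split => //=.
    by move: h; rewrite (cnt_marks Q lK lk) => -[/eqP]; rewrite eqr_nat => /eqP.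
  by rewrite (cnt_marks Q lK lk) h.
have gk : <<s allG K >> [set w | incr l w = k%:R%:E] by exact: incr_all.
have gXk := g_sigmaI gX gk.
rewrite (marks_step _ gXk k z).2 (@arrival_step l K); last exact: gE.
by rewrite -muleA EFinM.
Qed.

Lemma cntD Q a b c w : (a <= b)%N -> (b <= c)%N ->
  cnt Q a c w = (cnt Q a b w + cnt Q b c w)%E.
Proof.
move=> ab bc; rewrite /cnt -measureU//.
- congr counting; apply/seteqP; split => n /=.
    move=> [i [/andP[ai ic] iA QV]]; have [ib|bi] := ltnP i b; [left|right].
      by exists i; rewrite ai ib.
    by exists i; rewrite bi ic.
  case=> -[i [/andP[h1 h2] iA QV]]; exists i.
    by rewrite h1 (leq_trans h2 bc).
  by rewrite (leq_trans ab h1) h2.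
- rewrite -subset0 => n /= [[i [/andP[_ ib] /andP[_ Ai] _]] [j [/andP[bj _] /andP[jA _] _]]].
  by have := lt_le_trans jA Ai; rewrite ltr_nat ltnS leqNgt (leq_trans ib bj).
Qed.

Lemma cnt_natVy Q a b w : cnt Q a b w = +oo%E \/ exists n, cnt Q a b w = n%:R%:E.
Proof. exact: counting_natVy. Qed.

Lemma cntid Q a w : cnt Q a a w = 0%E.
Proof.
rewrite /cnt (_ : [set n | _] = set0) ?measure0// -subset0 => n /= [i [+ _ _]].
by move=> /andP[ai /(leq_ltn_trans ai)]; rewrite ltnn.
Qed.

(** Induction on the number of cells: the counts in the earlier cells belong to the past of the last
    one, so [cell_law] applies to it, and [poi_add] gives the law of the sum. *)
Lemma cnt_law Q l m E z : past l E ->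
  P (E `&` [set w | cnt Q l (l + m) w = z%:R%:E]) =
  (P E * (poi (lambda * \sum_(l <= i < l + m) tail (Q i)) z)%:E)%E.
Proof.
move=> pE; have mE := pE.1; elim: m z => [|m IH] z.
  rewrite addn0 big_geq// mulr0 poi0; case: eqP => [->|z0].
    rewrite mule1 (_ : [set w | _] = setT) ?setIT//.
    by apply/seteqP; split => // w _ /=; rewrite cntid.
  rewrite mule0 (_ : [set w | _] = set0) ?setI0 ?measure0//.
  rewrite -subset0 => w /=; rewrite cntid => -[/eqP]; rewrite eq_sym pnatr_eq0 => /eqP.
  by move=> /z0.
(* Of the [z] customers, [y] come from the first [m] cells and the others from the last cell. *)
pose F y := (E `&` [set w | cnt Q l (l + m) w = y%:R%:E]) `&`
  [set w | cnt Q (l + m) (l + m).+1 w = (z - y)%N%:R%:E].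
have pF y : past (l + m) (E `&` [set w | cnt Q l (l + m) w = y%:R%:E]).
  apply: pastI; last exact: cnt_past.
  by apply: past_mono pE; exact: leq_addr.
have mF y : measurable (F y).
  by apply: measurableI; [exact: (pF y).1|exact: measurable_cnt_eq].
have -> : E `&` [set w | cnt Q l (l + m.+1) w = z%:R%:E] = \big[setU/set0]_(y < z.+1) F y.
  rewrite -bigcup_mkord; apply/seteqP; split => w.
    move=> [Ew /=]; rewrite (@cntD Q l (l + m))//; [|exact: leq_addr|by rewrite addnS].
    have [->|[y e1]] := cnt_natVy Q l (l + m) w; rewrite addnS.
      by have [->|[? ->]] := cnt_natVy Q (l + m) (l + m).+1 w.
    have [->|[x e2]] := cnt_natVy Q (l + m) (l + m).+1 w; first by rewrite e1.
    rewrite e1 e2 -EFinD -natrD => -[/eqP]; rewrite eqr_nat => /eqP yx.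
    exists y; first by rewrite /= -yx ltnS leq_addr.
    by split; [split|rewrite /= e2 -yx addKn].
  move=> [y /= yz [[Ew /= e1] /= e2]]; split => //=.
  rewrite (@cntD Q l (l + m))//; [|exact: leq_addr|by rewrite addnS].
  by rewrite e1 addnS e2 -EFinD -natrD subnKC.
rewrite measure_bigsetU//; last first.
  apply/trivIsetP => i j _ _ /eqP ij; rewrite -subset0 => w [[[_ /= e] _] [[_ /=]]].
  by rewrite e => -[/eqP]; rewrite eqr_nat => /eqP.
rewrite addnS big_nat_recr/= ?leq_addr// mulrDr poi_add -sumEFin.
have fE : P E \is a fin_num by exact: fin_num_measure.
rewrite ge0_sume_distrr; last first.
  have tl i : 0 <= tail (Q i) by have /andP[] := tail01 (Q i).
  by move=> i _; rewrite lee_fin mulr_ge0 ?poi_ge0 ?mulr_ge0 ?(ltW lambda_gt0) ?sumr_ge0.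
apply: eq_bigr => y _.
by rewrite cell_law// IH -muleA EFinM.
Qed.

End queue_law.

(** * Truncated means and the integral test *)

Section truncated_mean_facts.
Context d (T : measurableType d) (R : realType) (P : probability T R).
Context (S : {RV P >-> R}).
Hypothesis S_ge0 : forall w, 0 <= S w.

Local Notation m := (truncated_mean P S).

Lemma measurable_min (t : R) : measurable_fun setT (fun w => Num.min (S w) t).
Proof. by apply: measurable_minr. Qed.

Lemma truncated_meanE t : 0 <= t -> (m t)%:E = (\int[P]_w (Num.min (S w) t)%:E)%E.
Proof.
move=> t0; rewrite /truncated_mean unlock fineK// ge0_fin_numE; last first.
  by apply: integral_ge0 => w _; rewrite lee_fin le_min S_ge0.
apply: (@le_lt_trans _ _ (\int[P]_w (cst t%:E w))%E).
  apply: ge0_le_integral => //.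
  - by move=> w _; rewrite lee_fin le_min S_ge0.
  - by apply/measurable_EFinP; exact: measurable_min.
  - by move=> w _; rewrite lee_fin ge_min lexx orbT.
by rewrite integral_cst//= probability_setT mule1 ltry.
Qed.

Lemma truncated_mean_le s t : 0 <= s -> s <= t -> m s <= m t.
Proof.
move=> s0 st; have t0 := le_trans s0 st.
rewrite -lee_fin !truncated_meanE//; apply: ge0_le_integral => //.
- by move=> w _; rewrite lee_fin le_min S_ge0.
- by apply/measurable_EFinP; exact: measurable_min.
- by apply/measurable_EFinP; exact: measurable_min.
- by move=> w _; rewrite lee_fin le_min !ge_min lexx st orbT.
Qed.

Lemma truncated_mean0 : m 0 = 0.
Proof.
apply: EFin_inj; rewrite truncated_meanE// integral0_eq// => w _.
by rewrite /Num.min ltNge S_ge0.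
Qed.

Lemma truncated_mean_ge0 t : 0 <= t -> 0 <= m t.
Proof. by move=> t0; rewrite -truncated_mean0 truncated_mean_le. Qed.

(** Puts mean and tail under one integral, which reduces the next comparison to a pointwise one. *)
Lemma truncated_mean_indic (t c : R) : 0 <= t ->
  (m t + tail S c)%:E =
  (\int[P]_w (Num.min (S w) t + \1_[set w | (c <= S w)%R] w)%:E)%E.
Proof.
move=> t0; under eq_integral do rewrite EFinD.
rewrite ge0_integralD//=.
- rewrite integral_indic//; last exact: measurable_tail.
  by rewrite setIT EFinD tailE truncated_meanE.
- by move=> w _; rewrite lee_fin le_min S_ge0.
- by apply/measurable_EFinP; exact: measurable_min.
- by apply/measurable_EFinP/measurable_indicP; exact: measurable_tail.
Qed.

(** The increment of [Num.min (S w)] from [n] to [n + 1] lies between the indicators of [S >= n + 1]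
    and of [S >= n]. *)
Lemma truncated_mean_step (n : nat) :
  m n%:R + tail S n.+1%:R <= m n.+1%:R <= m n%:R + tail S n%:R.
Proof.
have ind c w : (\1_[set w | (c <= S w)%R] w : R) = (c <= S w)%R%:R.
  rewrite indicE; congr (_%:R); congr nat_of_bool.
  by apply/idP/idP => [/set_mem|?]; last exact/mem_set.
have mind c : measurable_fun setT
    (fun w => (Num.min (S w) n%:R + \1_[set w | (c <= S w)%R] w)%:E : \bar R).
  apply/measurable_EFinP; apply: measurable_funD; first exact: measurable_min.
  by apply/measurable_indicP; exact: measurable_tail.
have nS : n.+1%:R = n%:R + 1 :> R by rewrite -natr1.
have n0 : 0 <= n%:R :> R by [].
rewrite -!lee_fin !truncated_mean_indic// truncated_meanE//; apply/andP; split.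
- apply: ge0_le_integral => //.
  + by move=> w _; rewrite lee_fin addr_ge0// le_min S_ge0.
  + by apply/measurable_EFinP; exact: measurable_min.
  + move=> w _; rewrite lee_fin ind nS; have := S_ge0 w.
    case: (leP (n%:R + 1) (S w)) => h _ /=; first by rewrite !min_r//; lra.
    by rewrite addr0 ge_min lexx.
- apply: ge0_le_integral => //.
  + by move=> w _; rewrite lee_fin le_min S_ge0 ler0n.
  + by apply/measurable_EFinP; exact: measurable_min.
  + move=> w _; rewrite lee_fin ind nS; have := S_ge0 w.
    case: (leP n%:R (S w)) => h _ /=; last by rewrite addr0 !min_l//; lra.
    by rewrite ge_min lexx orbT.
Qed.

Lemma truncated_mean_upper n : m n%:R <= \sum_(0 <= r < n) tail S r%:R.
Proof.
elim: n => [|n IH]; first by rewrite big_geq// truncated_mean0.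
rewrite big_nat_recr//=; have /andP[_ /le_trans -> //] := truncated_mean_step n.
by rewrite lerD2r.
Qed.

Lemma truncated_mean_lower n : \sum_(0 <= r < n) tail S r.+1%:R <= m n%:R.
Proof.
elim: n => [|n IH]; first by rewrite big_geq// truncated_mean0.
rewrite big_nat_recr//=; have /andP[+ _] := truncated_mean_step n.
by apply: le_trans; rewrite lerD2r.
Qed.

Lemma truncated_mean_lipschitz n : m n.+1%:R <= m n%:R + 1.
Proof.
have /andP[_ /le_trans -> //] := truncated_mean_step n.
by rewrite lerD2l; have /andP[] := tail01 S n%:R.
Qed.

(** By monotone convergence, a common bound on the truncated means would bound the mean of [S]. *)
Lemma truncated_mean_pinfty : ('E_P[S] = +oo)%E -> forall C : R, exists n : nat, C <= m n%:R.
Proof.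
move=> ES C; apply: contrapT => /forallNP bd.
have : (\int[P]_w (limn (fun n => (Num.min (S w) n%:R)%:E)) <= C%:E)%E.
  have cv := @cvg_monotone_convergence _ _ _ P setT measurableT
    (fun n w => (Num.min (S w) n%:R)%:E).
  rewrite -(cvg_lim _ (cv _ _ _))//.
  - apply: lime_le.
      apply: ereal_nondecreasing_is_cvgn => a b ab.
      by rewrite -!truncated_meanE// lee_fin truncated_mean_le// ler_nat.
    apply: nearW => n; rewrite -truncated_meanE// lee_fin.
    by have /negP := bd n; rewrite -ltNge => /ltW.
  - by move=> n; apply/measurable_EFinP; exact: measurable_min.
  - by move=> n w _; rewrite lee_fin le_min S_ge0/=.
  - by move=> w _ a b ab; rewrite lee_fin le_min !ge_min lexx ler_nat ab orbT.
suff -> : (\int[P]_w (limn (fun n => (Num.min (S w) n%:R)%:E)) = +oo)%E by rewrite leye_eq.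
rewrite -ES unlock; apply: eq_integral => w _; apply/cvg_lim => //.
apply: cvg_near_cst; near=> n; rewrite min_l//.
near: n; exact: nbhs_infty_ger.
Unshelve. all: by end_near. Qed.

End truncated_mean_facts.

(** * Comparison of [k_integral] with series of Poisson probabilities *)

Section series_integral_comparison.
Context d (T : measurableType d) (R : realType) (P : probability T R).
Context (S : {RV P >-> R}) (lambda : R).
Hypothesis S_ge0 : forall w, 0 <= S w.
Hypothesis lambda_gt0 : 0 < lambda.

Local Notation m := (truncated_mean P S).

(** The distribution function of the Poisson law of mean [a]. *)
Definition poi_le (a : R) (k : nat) : R := \sum_(z < k.+1) poi a z.

Lemma poi_le_ge0 a k : 0 <= a -> 0 <= poi_le a k.
Proof. by move=> a0; apply: sumr_ge0 => z _; exact: poi_ge0. Qed.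

Let f (k : nat) (t : R) : R := m t ^+ k * expR (- (lambda * m t)).

Lemma k_integrand_ge0 k t : 0 <= t -> 0 <= f k t.
Proof. by move=> t0; rewrite mulr_ge0 ?exprn_ge0 ?expR_ge0// truncated_mean_ge0. Qed.

Lemma measurable_k_integrand k :
  measurable_fun (`[0%R, +oo[%classic : set R) (fun t => (f k t)%:E).
Proof.
apply/measurable_EFinP.
have mm : measurable_fun (`[0%R, +oo[%classic : set R) m.
  (* Monotonicity of [m] is known for nonnegative times; composing with [Num.max 0] gives a function
     that is monotone on the whole line. *)
  have e : {in (`[0%R, +oo[%classic : set R), (fun t => m (Num.max 0 t)) =1 m}.
    by move=> t; rewrite inE/= in_itv/= andbT => t0; rewrite max_r.
  apply: eq_measurable_fun e _.
  apply: nondecreasing_measurable => // s t st.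
  apply: truncated_mean_le => //; first by rewrite le_max lexx.
  by rewrite ge_max !le_max lexx st orbT.
apply: measurable_funM; first exact: measurable_funX.
apply: (measurableT_comp (f := expR)) => //.
rewrite (_ : (fun t => _) = (fun t : R => - lambda * m t)); first exact: measurable_funM.
by apply/funext => t; rewrite mulNr.
Qed.

Lemma k_integral_series k : k_integral P lambda S k =
  (\sum_(0 <= n <oo) \int[lebesgue_measure]_(t in `[n%:R, n.+1%:R[) (f k t)%:E)%E.
Proof.
have U : `[0%R, +oo[%classic = \bigcup_n [set` `[n%:R, n.+1%:R[%R] :> set R.
  apply/seteqP; split => t /=; rewrite in_itv/= ?andbT.
    move=> t0; exists (Num.truncn t) => //=.
    by rewrite in_itv/=; exact: truncn_itv.
  by move=> [n _ /=]; rewrite in_itv/= => /andP[+ _]; exact: le_trans.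
rewrite /k_integral U ge0_integral_bigcup//.
- by rewrite -U; exact: measurable_k_integrand.
- by move=> t; rewrite -U /= in_itv/= andbT => t0; rewrite lee_fin k_integrand_ge0.
- apply/trivIsetP => i j _ _ ij; rewrite -subset0 => t [] /=.
  rewrite !in_itv/= => /andP[it ti] /andP[jt tj].
  have := le_lt_trans it tj; have := le_lt_trans jt ti.
  rewrite !ltr_nat !ltnS => ji iijj; move: ij; rewrite eqn_leq iijj ji //.
Qed.

Lemma cell_integral_cst (n : nat) (c : R) :
  (\int[lebesgue_measure]_(t in `[n%:R, n.+1%:R[) c%:E = c%:E)%E.
Proof.
rewrite integral_cst//= lebesgue_measure_itv/= lte_fin ltr_nat ltnSn.
by rewrite -EFinB -natrB// subSnn mule1.
Qed.

Lemma measurable_cell_k_integrand k (n : nat) :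
  measurable_fun (`[n%:R, n.+1%:R[%classic : set R) (fun t => (f k t)%:E).
Proof.
apply: measurable_funS (measurable_k_integrand k) => //.
move=> t /=; rewrite !in_itv/= andbT => /andP[+ _]; exact: le_trans.
Qed.

Lemma cell_bounds n t : n%:R <= t -> t < n.+1%:R -> m n%:R <= m t <= m n.+1%:R.
Proof.
move=> nt tn; have t0 : 0 <= t by exact: le_trans nt.
by rewrite !truncated_mean_le// ltW.
Qed.

(** For [t] in [[n, n + 1[], the tail sum [b n.+1] lies between [m t] and [1 + m t], so the
    integrand is at most a constant times the last term of [poi_le] at index [n + 1]. *)
Lemma k_integral_pinfty_series k : k_integral P lambda S k = +oo%E ->
  (\sum_(0 <= n <oo) (poi_le (lambda * \sum_(0 <= r < n) tail S r%:R) k)%:E = +oo)%E.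
Proof.
move=> koo; pose b n := \sum_(0 <= r < n) tail S r%:R.
have b0 n : 0 <= b n by apply: sumr_ge0 => r _; have /andP[] := tail01 S r%:R.
have q0 n : 0 <= poi_le (lambda * b n) k by rewrite poi_le_ge0// mulr_ge0// ltW.
(* The factorial and the power of [lambda] cancel those of [poi]; [expR lambda] pays for the gap of
   1 in the exponent. *)
pose C := k`!%:R * expR lambda / lambda ^+ k.
have lk : 0 < lambda ^+ k by rewrite exprn_gt0.
have C0 : 0 < C by rewrite divr_gt0// mulr_gt0 ?expR_gt0// ltr0n fact_gt0.
have b1 n : b n.+1 <= 1 + m n%:R.
  rewrite /b big_ltn// big_add1/= lerD//; first by have /andP[] := tail01 S 0.
  exact: truncated_mean_lower.
have bound n t : n%:R <= t -> t < n.+1%:R -> f k t <= C * poi_le (lambda * b n.+1) k.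
  move=> nt tn; have /andP[m1 m2] := cell_bounds nt tn.
  have m0 : 0 <= m t by rewrite truncated_mean_ge0//; exact: le_trans nt.
  apply: (@le_trans _ _ (C * poi (lambda * b n.+1) k)); last first.
    rewrite ler_wpM2l ?(ltW C0)// /poi_le big_ord_recr/= lerDr.
    by apply: sumr_ge0 => z _; rewrite poi_ge0// mulr_ge0// ltW.
  rewrite (_ : C * _ = b n.+1 ^+ k * expR (lambda - lambda * b n.+1)); last first.
    rewrite /C /poi expRD exprMn; field.
    by rewrite (gt_eqF lk) pnatr_eq0 gtn_eqF// fact_gt0.
  apply: ler_pM; rewrite ?exprn_ge0 ?expR_ge0//.
    apply: lerXn2r; rewrite ?nnegrE//.
    exact: le_trans m2 (truncated_mean_upper S_ge0 n.+1).
  rewrite ler_expR -{2}(mulr1 lambda) -mulrBr -mulrN ler_pM2l//.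
  by have := b1 n; lra.
have Cq0 n : (0 <= C%:E * (poi_le (lambda * b n) k)%:E)%E.
  by rewrite -EFinM lee_fin mulr_ge0// ltW.
apply/eqP; rewrite -leye_eq -(@lee_pmul2l _ C%:E)//.
rewrite mulry gtr0_sg// mul1e -koo k_integral_series.
rewrite -nneseriesZl; last by move=> n _; rewrite lee_fin; exact: q0.
rewrite [leRHS](nneseries_split 0 1); last by move=> n _; exact: Cq0.
rewrite -[leLHS]add0e; apply: leeD.
  by rewrite big_nat1; exact: Cq0.
rewrite add0n -nneseries_addn; last by move=> n; exact: Cq0.
apply: lee_nneseries => [n _ _|n _].
  apply: integral_ge0 => t /=; rewrite in_itv/= => /andP[nt _].
  by rewrite lee_fin k_integrand_ge0//; exact: le_trans nt.
rewrite -EFinM -(cell_integral_cst n) addn1; apply: ge0_le_integral => //.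
- move=> t /=; rewrite in_itv/= => /andP[nt _].
  by rewrite lee_fin k_integrand_ge0//; exact: le_trans nt.
- exact: measurable_cell_k_integrand.
- by move=> t /=; rewrite in_itv/= => /andP[nt tn]; rewrite lee_fin bound.
Qed.

(** For [t] in [[n, n + 1[], the tail sum [a n] lies between [m t - 2] and [m t + 1]. Once
    [m t >= 1], all powers up to [k] are dominated by a constant times [m t ^+ k], hence [poi_le] by
    the integrand. *)
Lemma k_integral_lty_series k : ('E_P[S] = +oo)%E ->
  (k_integral P lambda S k < +oo)%E ->
  (\sum_(0 <= n <oo) (poi_le (lambda * \sum_(0 <= r < n) tail S r.+2%:R) k)%:E < +oo)%E.
Proof.
move=> ES koo; pose a n := \sum_(0 <= r < n) tail S r.+2%:R.
have a0 n : 0 <= a n by apply: sumr_ge0 => r _; have /andP[] := tail01 S r.+2%:R.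
have q0 n : 0 <= poi_le (lambda * a n) k by rewrite poi_le_ge0// mulr_ge0// ltW.
(* There are [k + 1] terms; [lambda * a n] is at most [(1 + lambda) * (2 * m t)], a number at least
   1 whose [k]-th power bounds the lower ones; the exponential pays for the gap of 2. *)
pose C := k.+1%:R * (1 + lambda) ^+ k * 2 ^+ k * expR (lambda * 2).
have l1 : 1 <= 1 + lambda by rewrite lerDl ltW.
have C0 : 0 < C by rewrite !mulr_gt0 ?expR_gt0 ?exprn_gt0// addr_gt0.
have a1 n : m n.+1%:R - 2 <= a n.
  rewrite lerBlDr; apply: le_trans (_ : m n.+2%:R <= _).
    by apply: truncated_mean_le => //; rewrite ler_nat.
  apply: le_trans (truncated_mean_upper S_ge0 _) _.
  rewrite big_ltn// big_add1/= big_ltn// big_add1/= addrA addrC lerD2l.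
  by have /andP[_ h0] := tail01 S 0; have /andP[_ h1] := tail01 S 1; lra.
have a2 n : a n <= m n%:R + 1.
  apply: le_trans (truncated_mean_lipschitz S_ge0 n).
  apply: le_trans (truncated_mean_lower S_ge0 n.+1).
  rewrite big_ltn// big_add1/= lerDr.
  by have /andP[] := tail01 S 1.
have [N mN] := truncated_mean_pinfty S_ge0 ES 1.
have bound n t : (N <= n)%N -> n%:R <= t -> t < n.+1%:R ->
    poi_le (lambda * a n) k <= C * f k t.
  move=> Nn nt tn; have t0 : 0 <= t by exact: le_trans nt.
  have mt1 : 1 <= m t.
    apply: le_trans mN _; apply: truncated_mean_le => //.
    by apply: le_trans nt; rewrite ler_nat.
  have /andP[m1 m2] := cell_bounds nt tn.
  have am : a n <= m t + 1 by apply: le_trans (a2 n) _; rewrite lerD2r.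
  have ma : m t - 2 <= a n.
    by apply: le_trans (a1 n); rewrite lerD2r.
  have termwise z : (z < k.+1)%N -> poi (lambda * a n) z <=
      (1 + lambda) ^+ k * 2 ^+ k * expR (lambda * 2) * f k t.
    rewrite ltnS => zk.
    have -> : (1 + lambda) ^+ k * 2 ^+ k * expR (lambda * 2) * f k t =
      ((1 + lambda) * (2 * m t)) ^+ k * expR (lambda * 2 - lambda * m t).
      by rewrite /f expRD !exprMn; ring.
    have zz : 0 <= lambda * a n by rewrite mulr_ge0// ltW.
    apply: ler_pM; rewrite ?expR_ge0//.
    - by rewrite mulr_ge0// exprn_ge0.
    - apply: (@le_trans _ _ (((1 + lambda) * (2 * m t)) ^+ z)); last first.
        by apply: ler_weXn2l => //; apply: mulr_ege1 => //; apply: mulr_ege1 => //; lra.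
      rewrite ler_pdivrMr ?ltr0n ?fact_gt0// -[leLHS]mulr1; apply: ler_pM => //.
      + by rewrite exprn_ge0.
      + have h : lambda * a n <= (1 + lambda) * (2 * m t).
          by apply: ler_pM => //; [exact: ltW|rewrite lerDr|lra].
        by apply: lerXn2r => //; rewrite nnegrE//; exact: le_trans h.
      + by rewrite ler1n fact_gt0.
    - rewrite ler_expR -mulrBr -mulrN ler_pM2l//; lra.
  apply: le_trans (_ : \sum_(z < k.+1)
    (1 + lambda) ^+ k * 2 ^+ k * expR (lambda * 2) * f k t <= _).
    by apply: ler_sum => z _; exact: termwise.
  by rewrite sumr_const card_ord -[leLHS]mulr_natl /C !mulrA lexx.
rewrite (nneseries_split 0 N)//; last by move=> n _; rewrite lee_fin; exact: q0.
rewrite add0n lte_add_pinfty//.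
  by rewrite sumEFin ltry.
rewrite -nneseries_addn; last by move=> n; rewrite lee_fin; exact: q0.
have fC : (C%:E * k_integral P lambda S k < +oo)%E.
  rewrite lte_mul_pinfty// ?lee_fin ?ltW// //.
apply: le_lt_trans fC.
rewrite k_integral_series -nneseriesZl; last first.
  move=> n _; apply: integral_ge0 => t /=; rewrite in_itv/= => /andP[nt _].
  by rewrite lee_fin k_integrand_ge0//; exact: le_trans nt.
have g0 n : (0 <= C%:E * \int[lebesgue_measure]_(t in `[n%:R, n.+1%:R[) (f k t)%:E)%E.
  apply: mule_ge0; first by rewrite lee_fin ltW.
  apply: integral_ge0 => t /=; rewrite in_itv/= => /andP[nt _].
  by rewrite lee_fin k_integrand_ge0//; exact: le_trans nt.
rewrite [leRHS](nneseries_split 0 N)// add0n -[X in (_ <= _ + X)%E]nneseries_addn//.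
rewrite -[leLHS]add0e; apply: leeD; first by rewrite sume_ge0.
apply: lee_nneseries => [n _ _|n _]; first by rewrite lee_fin; exact: q0.
rewrite -(cell_integral_cst (n + N)) -ge0_integralZl_EFin//; first last.
- exact: ltW.
- exact: measurable_cell_k_integrand.
- move=> t /=; rewrite in_itv/= => /andP[nt _].
  by rewrite lee_fin k_integrand_ge0//; exact: le_trans nt.
apply: ge0_le_integral => //.
- by move=> t _; rewrite lee_fin; exact: q0.
- by apply: measurable_funeM; exact: measurable_cell_k_integrand.
- move=> t /=; rewrite in_itv/= => /andP[nt tn].
  by rewrite -EFinM lee_fin bound// leq_addl.
Qed.

End series_integral_comparison.

(** * The queue at integer times *)

Section cell_thresholds.
Context d (T : measurableType d) (R : realType) (P : probability T R).
Context (S : {RV P >-> R}).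

Lemma cell_exists (x : R) : 0 < x -> exists i : nat, i%:R < x <= i.+1%:R.
Proof.
move=> x0; have ex : exists i : nat, x <= i.+1%:R.
  by exists (Num.truncn x); rewrite ltW// truncnS_gt.
exists (ex_minn ex); case: ex_minnP => -[|i] xi imin; rewrite xi andbT//.
by rewrite ltNge; apply/negP => /imin; rewrite ltnn.
Qed.

(* A customer arrived in the cell ]i, i + 1] is present during the whole of
   [n, n + 1] if his service time is at least [Qlow n i], and is present at time
   j only if it is at least [Qup j i]. *)
Definition Qlow (n i : nat) : R := n.+1%:R - i%:R.
Definition Qup (j i : nat) : R := j%:R - i.+1%:R.

(** Counting cells backwards from time [n], cell [n - 1 - r] has threshold [r + 2]; for [Qup] below,
    the threshold is [r]. *)
Lemma sum_tail_low n :
  \sum_(0 <= i < n) tail S (Qlow n i) = \sum_(0 <= r < n) tail S r.+2%:R.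
Proof.
rewrite big_nat_rev/= !big_mkord; apply: eq_bigr => i _; congr (tail _ _).
rewrite /Qlow add0n -natrB; last by rewrite ltnW// ltnS leq_subr.
congr (_%:R); have := ltn_ord i; lia.
Qed.

Lemma sum_tail_up i j : (i <= j)%N ->
  \sum_(i <= l < j) tail S (Qup j l) = \sum_(0 <= r < j - i) tail S r%:R.
Proof.
move=> ij; rewrite -{1}(add0n i) big_addn big_nat_rev/= !big_mkord.
apply: eq_bigr => r _; congr (tail _ _).
rewrite /Qup -natrB; last by have := ltn_ord r; lia.
by congr (_%:R); have := ltn_ord r; lia.
Qed.

Lemma sum_shift_le (F : nat -> R) i n : (forall j, 0 <= F j) ->
  \sum_(j < n | (i <= j)%N) F (j - i)%N <= \sum_(j < n) F j.
Proof.
move=> F0; rewrite (eq_bigl (fun j : 'I_n => true && (i <= j)%N))//.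
rewrite -(big_geq_mkord i n xpredT (fun j => F (j - i)%N)) -{1}(add0n i) big_addn.
rewrite -(big_mkord xpredT F) [leRHS](@big_cat_nat _ _ _ (n - i))//= ?leq_subr//.
under eq_bigr do rewrite addnK.
by rewrite lerDl sumr_ge0.
Qed.

Lemma sum_lt_le n a : \sum_(j < n) (j < a)%N%:R <= a%:R :> R.
Proof.
rewrite -natr_sum ler_nat.
have -> : (\sum_(j < n) (j < a) = minn n a)%N.
  by elim: n => [|n IH]; rewrite ?big_ord0 ?min0n// big_ord_recr/= IH; lia.
exact: geq_minr.
Qed.

End cell_thresholds.

Section lattice_times.
Context d (T : measurableType d) (R : realType) (P : probability T R).
Context (lambda : R) (S : {RV P >-> R}) (A V : nat -> {RV P >-> R}).
Hypothesis lambda_gt0 : 0 < lambda.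
Hypothesis queue : MGinfty_queue lambda S A V.

Local Notation Y := (customers A V).
Local Notation cnt := (cnt A V).
Local Notation past := (past A V).

Lemma cnt_low_le n t w : n%:R <= t <= n.+1%:R -> (cnt (Qlow R n) 0 n w <= Y t w)%E.
Proof.
move=> /andP[nt tn]; apply: le_counting => k [i [/= ilt /andP[iA Ai] QV]].
have it : i.+1%:R <= t by apply: le_trans nt; rewrite ler_nat.
split; first exact: le_trans Ai it.
by apply: le_trans QV; rewrite /Qlow lerB// ltW.
Qed.

Lemma cnt_up_ge j w : (Y j%:R w <= cnt (Qup R j) 0 j w)%E.
Proof.
apply: le_counting => k [/= Aj AV].
have [i /andP[iA Ai]] := cell_exists (arrival_gt0 queue w k).
exists i; split; [|by rewrite iA|].
- by rewrite /= -(ltr_nat R) (lt_le_trans iA).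
- by apply: le_trans AV; rewrite /Qup lerB.
Qed.

Lemma sum_tail_ge0 (F : nat -> R) a b : 0 <= lambda * \sum_(a <= i < b) tail S (F i).
Proof.
rewrite mulr_ge0 ?(ltW lambda_gt0)//; apply: sumr_ge0 => i _.
by have /andP[] := tail01 S (F i).
Qed.

Lemma cnt_leE Q a b k : [set w | (cnt Q a b w <= k%:R%:E)%E] =
  \big[setU/set0]_(z < k.+1) [set w | cnt Q a b w = z%:R%:E].
Proof.
rewrite -(bigcup_mkord k.+1 (fun z => [set w | cnt Q a b w = z%:R%:E])).
apply/seteqP; split => w /=; last by move=> [z /= zk ->]; rewrite lee_fin ler_nat.
have [e|[z e]] := cnt_natVy A V Q a b w; rewrite e ?leye_eq//.
by rewrite lee_fin ler_nat => zk; exists z.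
Qed.

Lemma measurable_cnt_le Q a b k : measurable [set w | (cnt Q a b w <= k%:R%:E)%E].
Proof.
by rewrite cnt_leE; apply: bigsetU_measurable => z _; exact: measurable_cnt_eq.
Qed.

Lemma past_bigU l n (F : nat -> set T) : (forall i, (i < n)%N -> past l (F i)) ->
  past l (\big[setU/set0]_(i < n) F i).
Proof.
move=> pF; rewrite -bigcup_mkord -(setCK (\bigcup_(i in _) _)) setC_bigcup.
by apply/(pastC queue)/(past_bigcap queue) => i /= ilt; apply: (pastC queue); exact: pF.
Qed.

Lemma past_cnt_le Q a b k l : (b <= l)%N ->
  past l [set w | (cnt Q a b w <= k%:R%:E)%E].
Proof.
move=> bl; rewrite cnt_leE.
apply: (@past_bigU l k.+1 (fun z => [set w | cnt Q a b w = z%:R%:E])) => z _.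
exact: (cnt_past queue).
Qed.

(** Probabilities as real numbers, for the subtractions and divisions to come. *)
Definition pr (X : set T) : R := fine (P X).

Lemma prE X : measurable X -> (pr X)%:E = P X.
Proof. by move=> mX; rewrite fineK// fin_num_measure. Qed.

Lemma pr_ge0 X : 0 <= pr X.
Proof. by rewrite fine_ge0. Qed.

Lemma pr_le1 X : measurable X -> pr X <= 1.
Proof. by move=> mX; rewrite -lee_fin prE// probability_le1. Qed.

Lemma pr_le X X' : measurable X -> measurable X' -> X `<=` X' -> pr X <= pr X'.
Proof. by move=> mX mX' XX'; rewrite -lee_fin !prE//; apply: le_measure; rewrite ?inE. Qed.

Lemma pr_bigU n (F : nat -> set T) : (forall i, measurable (F i)) -> trivIset setT F ->
  pr (\big[setU/set0]_(i < n) F i) = \sum_(i < n) pr (F i).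
Proof.
move=> mF tF; apply: EFin_inj; rewrite prE; last exact: bigsetU_measurable.
by rewrite measure_bigsetU// -sumEFin; apply: eq_bigr => i _; rewrite prE.
Qed.

Lemma cnt_le_law Q l m k E : past l E ->
  pr (E `&` [set w | (cnt Q l (l + m) w <= k%:R%:E)%E]) =
  pr E * poi_le (lambda * \sum_(l <= i < l + m) tail S (Q i)) k.
Proof.
move=> pE; have mE := pE.1.
rewrite cnt_leE big_distrr/=.
rewrite (@pr_bigU _ (fun z => E `&` [set w | cnt Q l (l + m) w = z%:R%:E])).
- rewrite /poi_le mulr_sumr; apply: eq_bigr => z _; apply: EFin_inj.
  rewrite EFinM !prE//; last by apply: measurableI => //; exact: measurable_cnt_eq.
  exact: (cnt_law lambda_gt0 queue).
- by move=> i; apply: measurableI => //; exact: measurable_cnt_eq.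
- apply/trivIsetP => i j _ _ /eqP ij; rewrite -subset0 => w [[_ /= e] [_ /=]].
  by rewrite e => -[/eqP]; rewrite eqr_nat => /eqP.
Qed.

Lemma cnt_le_law0 Q m k : pr [set w | (cnt Q 0 m w <= k%:R%:E)%E] =
  poi_le (lambda * \sum_(0 <= i < m) tail S (Q i)) k.
Proof.
have := @cnt_le_law Q 0 m k setT (pastT queue 0).
by rewrite setTI add0n => ->; rewrite /pr probability_setT mul1r.
Qed.

Let q (k j : nat) : R := poi_le (lambda * \sum_(0 <= r < j) tail S r%:R) k.
Let H (k j : nat) : set T := [set w | (cnt (Qup R j) 0 j w <= k%:R%:E)%E].

Let q_ge0 k j : 0 <= q k j. Proof. exact/poi_le_ge0/sum_tail_ge0. Qed.

Let prH k j : pr (H k j) = q k j.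
Proof. by rewrite /H cnt_le_law0 sum_tail_up// subn0. Qed.

(* The customers arrived after time i are a fresh copy of the process, and the
   earlier ones can only increase the count at time j. *)
Lemma past_upto_le k i j E : (i <= j)%N -> past i E ->
  pr (E `&` H k j) <= pr E * q k (j - i).
Proof.
move=> ij pE; have mE := pE.1.
have := @cnt_le_law (Qup R j) i (j - i) k E pE.
rewrite subnKC// sum_tail_up// -/(q k (j - i)) => <-.
apply: pr_le.
- by apply: measurableI => //; exact: measurable_cnt_le.
- by apply: measurableI => //; exact: measurable_cnt_le.
- apply: setIS => w; apply: le_trans.
  by rewrite (@cntD _ _ _ _ A V (Qup R j) 0 i)//; exact: leeDr.
Qed.

(** A first-entrance decomposition shows that [(1 - p)] times every partial sum of the divergent
    series is at most [a], where [p] is the probability of the union; this forces [p = 1]. *)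
Lemma hitting k a : (\sum_(0 <= n <oo) (q k n)%:E = +oo)%E ->
  P (\bigcup_(j in [set j | (a <= j)%N]) H k j) = 1%E.
Proof.
move=> qoo.
pose H' j := if (a <= j)%N then H k j else set0.
have -> : \bigcup_(j in [set j | (a <= j)%N]) H k j = \bigcup_j H' j.
  apply/seteqP; split => w [j].
    by move=> /= aj Hj; exists j => //; rewrite /H' aj.
  by move=> _; rewrite /H'; case: ifPn => // aj Hj; exists j.
have pH j i : (i <= j)%N -> past j (H' i).
  move=> ij; rewrite /H'; case: ifPn => _; first exact: past_cnt_le.
  by rewrite -setCT; exact: (pastC queue (pastT queue j)).
have mH' j : measurable (H' j) by exact: (pH j j (leqnn j)).1.
(* [tau i] says that [i] is the first time from [a] on at which the event occurs; it belongs to the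
   past of [i]. *)
pose tau := seqDU H'.
have ptau i : past i (tau i).
  rewrite /tau /seqDU setDE; apply: pastI; first exact: pH.
  by apply: (pastC queue); apply: past_bigU => l li; apply: pH; exact: ltnW.
have mtau i : measurable (tau i) by exact: (ptau i).1.
have ttau : trivIset setT tau by exact: trivIset_seqDU.
have mU : measurable (\bigcup_j H' j) by exact: bigcupT_measurable.
set p := pr (\bigcup_j H' j).
have tau_p n : \sum_(i < n) pr (tau i) <= p.
  rewrite -pr_bigU//; apply: pr_le => //; first exact: bigsetU_measurable.
  by rewrite -bigsetU_seqDU -bigcup_mkord; apply: bigcup_sub => i _; exact: bigcup_sup.
have decomp j : pr (H' j) <= \sum_(i < j.+1) pr (tau i) * q k (j - i).
  rewrite [X in pr X](_ : _ = \big[setU/set0]_(i < j.+1) (tau i `&` H' j)).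
    rewrite (@pr_bigU _ (fun i => tau i `&` H' j)).
    + apply: ler_sum => i _; rewrite /H'; case: ifPn => _.
        by apply: past_upto_le => //; rewrite -ltnS.
      by rewrite setI0 /pr measure0 mulr_ge0// pr_ge0.
    + by move=> i; exact: measurableI.
    + exact: trivIset_setIr.
  rewrite -big_distrl/= -bigsetU_seqDU setIidr// big_ord_recr/=.
  exact: subsetUr.
(* Exchange the two sums: each shifted sum of [q] is at most the full one, and the probabilities of
   the [tau i] add up to at most [p]. *)
have key n : \sum_(j < n) pr (H' j) <= p * \sum_(j < n) q k j.
  apply: (@le_trans _ _ (\sum_(j < n) \sum_(i < n | (i <= j)%N) pr (tau i) * q k (j - i))).
    apply: ler_sum => j _; apply: le_trans (decomp j) _.
    by rewrite (big_ord_widen_cond n xpredT (fun i => pr (tau i) * q k (j - i)))//.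
  rewrite (exchange_big_dep xpredT)//=.
  apply: (@le_trans _ _ (\sum_(i < n) pr (tau i) * \sum_(j < n) q k j)).
    apply: ler_sum => i _; rewrite -mulr_sumr ler_wpM2l ?pr_ge0//.
    exact: sum_shift_le.
  by rewrite -mulr_suml ler_wpM2r// sumr_ge0.
(* [H'] differs from [H] at the [a] first times, each of which contributes at most 1. *)
have key2 n : (1 - p) * \sum_(j < n) q k j <= a%:R.
  rewrite mulrBl mul1r lerBlDr; apply: le_trans (lerD (lexx _) (key n)).
  apply: le_trans (lerD (sum_lt_le R n a) (lexx _)).
  rewrite -big_split/=; apply: ler_sum => j _; rewrite /H'.
  have [aj|ja] := leqP a j; first by rewrite add0r prH.
  by rewrite -prH (le_trans (pr_le1 (measurable_cnt_le _ _ _ _)))// lerDl pr_ge0.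
have p1 : p <= 1 by exact: pr_le1.
rewrite -prE// -/p; congr EFin; apply/eqP; rewrite eq_le p1/= leNgt; apply/negP => plt.
suff : (\sum_(0 <= n <oo) (q k n)%:E <= (a%:R / (1 - p))%:E)%E by rewrite qoo leye_eq.
apply: lime_le; first by apply: is_cvg_nneseries => n _ _; rewrite lee_fin.
apply: nearW => n; rewrite sumEFin lee_fin ler_pdivlMr ?subr_gt0// mulrC big_mkord.
exact: key2.
Qed.

End lattice_times.

(** * A Poisson bound, a discrete intermediate value theorem and limits inferior *)

Lemma poi_le_bound (R : realType) (x : R) (n : nat) : 0 < x ->
  poi_le x n <= n.+1%:R ^+ 2 / x.
Proof.
move=> x0; apply: (@le_trans _ _ (\sum_(z < n.+1) n.+1%:R / x)); last first.
  by rewrite sumr_const card_ord -[leLHS]mulr_natl expr2 mulrA.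
apply: ler_sum => z _; have zn := ltn_ord z.
apply: (@le_trans _ _ (z.+1%:R / x)); last by rewrite ler_pM2r ?invr_gt0// ler_nat.
have f0 k : 0 < k`!%:R :> R by rewrite ltr0n fact_gt0.
(* [expR x] is at least the term of degree [z + 1] of its series, so [poi x z] is at most
   [(z + 1) / x]. *)
have := expR_ge1Dxn z (ltW x0) => h.
rewrite /poi expRN -/(_ / _) ler_pdivrMr ?expR_gt0//.
apply: (@le_trans _ _ (z.+1%:R / x * (x ^+ z.+1 / z.+1`!%:R))).
  rewrite factS natrM exprS le_eqVlt; apply/orP; left; apply/eqP; field.
  by rewrite !gt_eqF// ltr0n.
by rewrite ler_wpM2l ?divr_ge0 ?(ltW x0)//; apply: le_trans h; rewrite lerDr.
Qed.

(** Take the least [j >= j0] with [n <= g j]: if it is not [j0], the preceding value is below [n]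
    and one step gains at most 1. Downward steps may be of any size. *)
Lemma discrete_ivt (g : nat -> nat) (j0 j1 n : nat) : (j0 <= j1)%N ->
  (g j0 <= n)%N -> (n <= g j1)%N -> (forall j, (g j.+1 <= (g j).+1)%N) ->
  exists2 j, (j0 <= j)%N & g j = n.
Proof.
move=> j01 g0 g1 gS.
have ex : exists j, (j0 <= j)%N && (n <= g j)%N by exists j1; rewrite j01.
exists (ex_minn ex); first by case: ex_minnP => j /andP[].
case: ex_minnP => j /andP[jj gj] jmin; apply/eqP; rewrite eqn_leq gj andbT.
have [e|jj'] := eqVneq j0 j; first by rewrite -e.
case: j jj gj jmin jj' => [|j] jj gj jmin jj'; first by move: jj; rewrite leqn0 (negPf jj').
have {}jj' : (j0 <= j)%N by move: jj; rewrite leq_eqVlt (negPf jj').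
apply: leq_trans (gS j) _; rewrite ltnNge; apply/negP => h.
by have := jmin j; rewrite jj' h ltnn => /(_ isT).
Qed.

Section limit_inferior.
Context {R : realType}.
Implicit Types (f : R -> \bar R) (x : \bar R).

Lemma limf_einf_ge f x (N : R) : (forall t, N <= t -> (x <= f t)%E) ->
  (x <= limf_einf f (pinfty_nbhs R))%E.
Proof.
move=> h; rewrite limf_einfE.
apply: (@le_trans _ _ (ereal_inf (f @` [set t | N < t]))).
  by apply: le_ereal_inf_tmp => _ [t /= Nt <-]; apply: h; exact: ltW.
apply: ereal_sup_ubound; exists [set t | N < t] => //.
by exists N; split; [exact: num_real|].
Qed.

Lemma limf_einf_le f x : (forall N : R, exists2 t, N < t & (f t <= x)%E) ->
  (limf_einf f (pinfty_nbhs R) <= x)%E.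
Proof.
move=> h; rewrite limf_einfE; apply: ge_ereal_sup => _ [U [M [_ MU]] <-].
have [t Mt ftx] := h M; apply: le_trans ftx.
by apply: ereal_inf_lbound; exists t => //; exact: MU.
Qed.

End limit_inferior.

(** * Almost sure behaviour *)

Section almost_sure.
Context d (T : measurableType d) (R : realType) (P : probability T R).
Context (lambda : R) (S : {RV P >-> R}) (A V : nat -> {RV P >-> R}).
Hypothesis lambda_gt0 : 0 < lambda.
Hypothesis S_ge0 : forall w, 0 <= S w.
Hypothesis queue : MGinfty_queue lambda S A V.
Hypothesis ES : ('E_P[S] = +oo)%E.

Local Notation Y := (customers A V).

Lemma ae_of_prob1 (E : set T) (Q : T -> Prop) : measurable E -> P E = 1%E ->
  (forall w, E w -> Q w) -> {ae P, forall w, Q w}.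
Proof.
move=> mE PE EQ; exists (~` E); split; first exact: measurableC.
  by rewrite probability_setC// PE subee.
by move=> w /= nQ Ew; apply: nQ; exact: EQ.
Qed.

Lemma customers_low n t w k : n%:R <= t <= n.+1%:R ->
  ~ (cnt A V (Qlow R n) 0 n w <= k%:R%:E)%E -> (k.+1%:R%:E <= Y t w)%E.
Proof.
move=> nt h; apply: le_trans (cnt_low_le A V w nt).
have [e|[z e]] := cnt_natVy A V (Qlow R n) 0 n w; rewrite e ?leey//.
by move: h; rewrite e !lee_fin !ler_nat ltnNge => /negP.
Qed.

(** Borel-Cantelli for the lower counts. The count at [n] bounds the process during all of
    [[n, n + 1]], so that integer times control all real times. *)
Lemma ae_lower k : (k_integral P lambda S k < +oo)%E ->
  {ae P, forall w, exists N : nat, forall t, N%:R <= t -> (k.+1%:R%:E <= Y t w)%E}.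
Proof.
move=> koo; pose F n := [set w | (cnt A V (Qlow R n) 0 n w <= k%:R%:E)%E].
have mF n : measurable (F n) by exact: measurable_cnt_le.
have P0 : P (lim_sup_set F) = 0%E.
  apply: lim_sup_set_cvg0 => //.
  apply: le_lt_trans (k_integral_lty_series S_ge0 lambda_gt0 ES koo).
  apply: lee_nneseries => [n _ _|n _]; first exact: measure_ge0.
  rewrite -sum_tail_low -(cnt_le_law0 lambda_gt0 queue) prE//; exact: mF.
exists (lim_sup_set F); split => //.
  by apply: bigcap_measurableType => n _; apply: bigcup_measurable.
move=> w /= h n _; apply: contrapT => h'; apply: h; exists n => t nt.
have t0 : 0 <= t by exact: le_trans nt.
have /andP[jt tj] := truncn_itv t0.
apply: (@customers_low (Num.truncn t)); first by rewrite jt ltW.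
move=> Fj; apply: h'; exists (Num.truncn t) => //=.
by rewrite -ltnS -(ltr_nat R); exact: le_lt_trans nt tj.
Qed.

Lemma ae_upper k : k_integral P lambda S k = +oo%E ->
  {ae P, forall w, forall a : nat, exists2 j, (a <= j)%N & (Y j%:R w <= k%:R%:E)%E}.
Proof.
move=> koo; apply: ae_foralln => a.
have qoo := k_integral_pinfty_series S_ge0 lambda_gt0 koo.
apply: (ae_of_prob1 _ (hitting lambda_gt0 queue a qoo)).
  by apply: bigcup_measurable => j _; exact: measurable_cnt_le.
by move=> w [j aj Hj]; exists j => //; exact: le_trans (cnt_up_ge queue j w) Hj.
Qed.

(** If the lower count stayed at most [n] from time [a] on with positive probability, this
    probability would be bounded by Poisson probabilities whose means tend to infinity. *)
Lemma ae_large :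
  {ae P, forall w, forall n a : nat, exists2 j, (a <= j)%N & (n.+1%:R%:E <= Y j%:R w)%E}.
Proof.
apply: ae_foralln => n; apply: ae_foralln => a.
pose F j := [set w | (cnt A V (Qlow R j) 0 j w <= n%:R%:E)%E].
pose B := \bigcap_(j in [set j | (a <= j)%N]) F j.
have mF j : measurable (F j) by exact: measurable_cnt_le.
have mB : measurable B by apply: bigcap_measurableType => j _.
exists B; split => //; last first.
  move=> w /= h j /= aj; apply: contrapT => nF; apply: h; exists j => //.
  by apply: customers_low nF; rewrite lexx ler_nat leqnSn.
apply: etrans (esym (prE P mB)) _; congr EFin; apply/eqP; rewrite eq_le pr_ge0 andbT leNgt.
apply/negP => p0.
(* A mean of at least [C] makes the bound of [poi_le_bound] smaller than [pr P B]. *)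
pose C := n.+1%:R ^+ 2 / (pr P B) + 1.
have C0 : 0 < C by rewrite addr_gt0// divr_gt0// exprn_gt0.
(* The 2 makes up for the first two tails, absent from the sum in [x]. *)
have [m mC] := truncated_mean_pinfty S_ge0 ES (C / lambda + 2).
pose j := maxn a m; pose x := lambda * \sum_(0 <= r < j) tail S r.+2%:R.
have xC : C <= x.
  rewrite /x -ler_pdivrMl// mulrC -(lerD2r 2); apply: le_trans mC _.
  apply: (@le_trans _ _ (truncated_mean P S j.+2%:R)).
    apply: truncated_mean_le => //; rewrite ler_nat.
    exact: leq_trans (leq_maxr a m) (leqW (leqnSn j)).
  apply: le_trans (truncated_mean_upper S_ge0 _) _.
  rewrite big_ltn// big_add1/= big_ltn// big_add1/= addrA addrC lerD2l.
  by have /andP[_ h0] := tail01 S 0; have /andP[_ h1] := tail01 S 1; lra.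
have : pr P B <= pr P (F j) by apply: pr_le => //; apply: bigcap_inf; exact: leq_maxl.
rewrite (cnt_le_law0 lambda_gt0 queue) sum_tail_low -/x leNgt => /negP; apply.
have x0 : 0 < x by exact: lt_le_trans xC.
apply: le_lt_trans (poi_le_bound n x0) _.
rewrite ltr_pdivrMr// mulrC -ltr_pdivrMr//; apply: lt_le_trans xC.
by rewrite ltrDl.
Qed.

Lemma ae_finite_arrivals :
  {ae P, forall w, forall l : nat, exists K, upto A l%:R K w}.
Proof.
apply: ae_foralln => l.
have mU : measurable (\bigcup_K upto A l%:R K).
  apply: bigcupT_measurable => K; apply: (@all_sub _ _ _ P A V K).
  by apply: past_sub; exact: (past_upto queue).
apply: (ae_of_prob1 mU); last by move=> w [K _ h]; exists K.
have := past_total lambda_gt0 queue l mU.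
under eq_eseriesr => K _.
  rewrite (_ : _ `&` _ = upto A l%:R K); last by rewrite setIidr//; exact: bigcup_sup.
  rewrite (upto_prob lambda_gt0 queue); over.
by rewrite poi_sum// mulr_ge0// ltW.
Qed.

(** * Arrival times are almost surely distinct *)

Lemma counting_pair n : counting [set k | (k < n.+2)%N /\ (n <= k)%N] = 2%:R%:E :> \bar R.
Proof.
rewrite (counting_bound n.+2 (leq n)) !big_ord_recr/= leqnn leqnSn big1//.
by move=> i _; rewrite leqNgt ltn_ord.
Qed.

Lemma multiple_arrivals (s t : R) : 0 <= s -> s < t ->
  pr P (~` ([set w | arrivals_in A s t w = 0%:R%:E] `|`
            [set w | arrivals_in A s t w = 1%:R%:E])) <=
  (lambda * (t - s)) ^+ 2.
Proof.
move=> s0 st; have x0 : 0 < lambda * (t - s) by rewrite mulr_gt0// subr_gt0.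
have m k : measurable [set w | arrivals_in A s t w = k%:R%:E].
  exact: measurable_arrivals_eq.
rewrite -lee_fin prE; last exact/measurableC/measurableU.
rewrite probability_setC; last exact: measurableU.
rewrite measureU//; last first.
  by rewrite -subset0 => w [/= ->] [/eqP]; rewrite eqr_nat.
have law k := poisson_increment_law (queue_arrivals queue) k s0 st.
rewrite [X in (_ - (X + _))%E]law [X in (_ - (_ + X))%E]law.
set x := lambda * (t - s).
suff : ((1 - (poi x 0 + poi x 1))%:E <= (x ^+ 2)%:E)%E by rewrite !poisson_pmfE.
rewrite lee_fin lerBlDr -lerBlDl.
exact/poi_sum2_ge/ltW.
Qed.

(** Cut []0, l]] into intervals of length [1 / (N + 1)]. Coinciding arrivals fall in one of them,
    which has probability at most [l * lambda ^+ 2 / (N + 1)] by [multiple_arrivals], and [N] is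
    arbitrary. *)
Lemma simultaneous_arrivals n (l : nat) :
  P ([set w | A n.+1 w <= A n w] `&` [set w | A n w <= l%:R]) = 0%E.
Proof.
set D := _ `&` _.
have mD : measurable D.
  apply: measurableI; last exact: measurable_arrival_le.
  by rewrite -[X in measurable X]setTI; exact: measurable_fun_le.
have bound N : pr P D <= l%:R * lambda ^+ 2 / N.+1%:R.
  pose t (i : nat) : R := i%:R / N.+1%:R.
  have tS i : t i.+1 - t i = N.+1%:R^-1 by rewrite /t -mulrBl -natrB// subSnn mul1r.
  pose G i := ~` ([set w | arrivals_in A (t i) (t i.+1) w = 0%:R%:E] `|`
                  [set w | arrivals_in A (t i) (t i.+1) w = 1%:R%:E]).
  have mG i : measurable (G i).
    by apply/measurableC/measurableU; exact: measurable_arrivals_eq.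
  have DG : D `<=` \big[setU/set0]_(i < l * N.+1) G i.
    rewrite -bigcup_mkord => w [/= e Al].
    have N0 : 0 < N.+1%:R :> R by [].
    have [i /andP[iA Ai]] := cell_exists (mulr_gt0 (arrival_gt0 queue w n) N0).
    exists i => /=.
      by rewrite -(ltr_nat R) natrM; apply: lt_le_trans iA _; rewrite ler_pM2r.
    have two : (2%:R%:E <= arrivals_in A (t i) (t i.+1) w)%E.
      rewrite -(counting_pair n); apply: le_counting => k /= [kn nk].
      have -> : A k w = A n w.
        apply/eqP; rewrite eq_le (arrival_mono queue w nk) andbT.
        by apply: le_trans e; exact: (arrival_mono queue w).
      by rewrite ltr_pdivrMr// iA/= ler_pdivlMr.
    by case=> /= e'; move: two; rewrite e' lee_fin ler_nat.
  have : (P D <= \sum_(i < l * N.+1) P (G i))%E by exact: content_subadditive.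
  rewrite -prE//; under eq_bigr do rewrite -(prE P (mG _)).
  rewrite sumEFin lee_fin => /le_trans; apply.
  apply: (@le_trans _ _ (\sum_(i < l * N.+1) (lambda / N.+1%:R) ^+ 2)).
    apply: ler_sum => i _; rewrite -(tS i); apply: multiple_arrivals.
      by rewrite divr_ge0.
    by rewrite -subr_gt0 tS invr_gt0.
  rewrite sumr_const card_ord -[leLHS]mulr_natl natrM le_eqVlt; apply/orP; left.
  by apply/eqP; field.
apply: etrans (esym (prE P mD)) _; congr EFin; apply/eqP; rewrite eq_le pr_ge0 andbT leNgt.
apply/negP => p0; pose C := l%:R * lambda ^+ 2 / pr P D.
have := bound (Num.truncn C); rewrite leNgt => /negP; apply.
rewrite ltr_pdivrMr// [ltRHS]mulrC -ltr_pdivrMr// -/C.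
exact: truncnS_gt.
Qed.

Lemma ae_increasing_arrivals : {ae P, forall w, forall n, A n w < A n.+1 w}.
Proof.
have : {ae P, forall w, forall n l : nat, ~ (A n.+1 w <= A n w /\ A n w <= l%:R)}.
  apply: ae_foralln => n; apply: ae_foralln => l.
  exists ([set w | A n.+1 w <= A n w] `&` [set w | A n w <= l%:R]); split => //.
  - apply: measurableI; last exact: measurable_arrival_le.
    by rewrite -[X in measurable X]setTI; exact: measurable_fun_le.
  - exact: simultaneous_arrivals.
  - by move=> w /= /contrapT.
apply: filterS => w h n; rewrite ltNge; apply/negP => le.
by apply: (h n (Num.truncn (A n w)).+1); split => //; rewrite ltW// truncnS_gt.
Qed.

(** * Visits to every state *)

Lemma customers_upto t K w : upto A t K w ->
  Y t w = (\sum_(i < K) (t - A i w <= V i w)%R)%N%:R%:E.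
Proof.
move=> tK; rewrite -(counting_bound K (fun i => t - A i w <= V i w)).
by congr counting; apply/seteqP; split => i /=; rewrite tK.
Qed.

(** The system is empty at some integer [s >= a] and holds more than the target number at a later
    [r]. Between them it is observed at arrival times, where [discrete_ivt] applies; state 0 is met
    at [s] itself. *)
Lemma visits_every_state w :
  (forall n, A n w < A n.+1 w) -> (forall l : nat, exists K, upto A l%:R K w) ->
  (forall a : nat, exists2 j, (a <= j)%N & (Y j%:R w <= 0%:R%:E)%E) ->
  (forall n a : nat, exists2 j, (a <= j)%N & (n.+1%:R%:E <= Y j%:R w)%E) ->
  forall n a : nat, exists2 t, a%:R <= t & Y t w = n%:R%:E.
Proof.
move=> inc fin hit0 large n a.
(* As arrivals are distinct, exactly [j + 1] customers have arrived at the time of arrival [j]. *)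
have uptoA j : upto A (A j w) j.+1 w.
  move=> i; rewrite ltnS; apply/idP/idP => [|ij]; last exact: arrival_mono queue w i j ij.
  apply: contraTT; rewrite -ltnNge -ltNge => ji.
  exact: lt_le_trans (inc j) (arrival_mono queue w ji).
have [s aS Ys] := hit0 a; have [K0 sK0] := fin s.
have as' : a%:R <= s%:R :> R by rewrite ler_nat.
case: n => [|n].
  exists s%:R => //; apply/eqP; rewrite eq_le Ys/=.
  by rewrite (customers_upto sK0) lee_fin.
have gone i : (i < K0)%N -> (s%:R - A i w <= V i w) = false.
  move: Ys; rewrite (customers_upto sK0) lee_fin ler_nat leqn0 sum_nat_eq0.
  by move=> /forallP h iK0; have := h (Ordinal iK0); rewrite /= eqb0 => /negbTE.
have [r sr Yr] := large n.+1 s; have [K1 rK1] := fin r.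
have sr' : s%:R <= r%:R :> R by rewrite ler_nat.
move: Yr; rewrite (customers_upto rK1) lee_fin ler_nat => Yr.
pose g j := (\sum_(i < j.+1) (A j w - A i w <= V i w)%R)%N.
(* Those who arrived by [s] have left, so a nonempty system at [r] requires an arrival after [s]. *)
have K01 : (K0 < K1)%N.
  rewrite ltnNge; apply/negP => K10; move: Yr; rewrite big1// => i _.
  apply/eqP; rewrite eqb0 -ltNge.
  have := gone i (leq_trans (ltn_ord i) K10) => /negbT; rewrite -ltNge => /lt_le_trans.
  by apply; rewrite lerD2r.
case: K1 rK1 Yr K01 => [//|K1] rK1 Yr K01.
have [j Kj gj] : exists2 j, (K0 <= j)%N & g j = n.+1.
  (* [K0] is the first arrival after [s], with at most one customer present; [K1], after the shift,
     is the last arrival by [r], when at least those present at [r] are there. *)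
  apply: (@discrete_ivt g K0 K1) => //.
  - rewrite /g big_ord_recr/= big1 ?add0n; first exact: leq_trans (leq_b1 _) _.
    move=> i _; apply/eqP; rewrite eqb0 -ltNge.
    have := gone i (ltn_ord i) => /negbT; rewrite -ltNge => /lt_le_trans; apply.
    by rewrite lerD2r ltW// ltNge sK0 ltnn.
  - apply: leq_trans (leq_trans (leqnSn _) Yr) _.
    apply: leq_sum => i _; case: (leP (r%:R - _)) => // h.
    by rewrite lt0b (le_trans _ h)// lerD2r rK1.
  - move=> j; rewrite /g big_ord_recr/= -[X in (_ <= X)%N]addn1.
    apply: leq_add; last exact: leq_b1.
    apply: leq_sum => i _; case: (leP (A j.+1 w - _)) => // h.
    by rewrite lt0b (le_trans _ h)// lerD2r ltW.
exists (A j w); last by rewrite (customers_upto (uptoA j)) -gj.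
by apply: le_trans as' _; rewrite ltW// ltNge sK0 -leqNgt.
Qed.

(** * Identification of the limit inferior *)

Lemma k0_pinfty : (forall k, (k_integral P lambda S k < +oo)%E) -> k0 P lambda S = +oo%E.
Proof.
move=> h; rewrite /k0 (_ : [set _ | _ in _] = set0) ?ereal_inf0//.
by rewrite -subset0 => x [k /= koo]; have := h k; rewrite koo ltxx.
Qed.

Lemma k0_least k : k_integral P lambda S k = +oo%E ->
  (forall j, (j < k)%N -> (k_integral P lambda S j < +oo)%E) ->
  k0 P lambda S = k%:R%:E.
Proof.
move=> koo h; apply/eqP; rewrite eq_le; apply/andP; split.
  by apply: ereal_inf_lbound; exists k.
apply: le_ereal_inf_tmp => _ [j /= joo <-]; rewrite lee_fin ler_nat leqNgt.
by apply/negP => /h; rewrite joo ltxx.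
Qed.

Lemma ae_escape : (forall k, (k_integral P lambda S k < +oo)%E) ->
  {ae P, forall w, forall k : nat, exists N : nat,
    forall t, N%:R <= t -> (k.+1%:R%:E <= Y t w)%E}.
Proof. by move=> h; apply: ae_foralln => k; exact: ae_lower. Qed.

Lemma ae_limf_einf :
  {ae P, forall w, limf_einf (fun t => Y t w) (pinfty_nbhs R) = k0 P lambda S}.
Proof.
have [[k koo]|/forallNP fin] := pselect (exists k, k_integral P lambda S k = +oo%E); last first.
  have h k : (k_integral P lambda S k < +oo)%E by rewrite ltey; apply/eqP; exact: fin.
  rewrite k0_pinfty//; have := ae_escape h; apply: filterS => w low.
  apply/eqyP => M M0; have [N hN] := low (Num.truncn M).
  apply: le_trans (limf_einf_ge hN); rewrite lee_fin; apply/ltW; exact: truncnS_gt.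
have ex : exists k, `[< k_integral P lambda S k = +oo%E >] by exists k; exact/asboolP.
(* For the least such [k], the finite integral at [k - 1] gives [Y >= k] eventually, and the
   infinite one at [k] gives [Y <= k] at arbitrarily late times; for [k = 0] the lower bound is the
   positivity of counts. *)
case: (ex_minnP ex) => {koo}{}k /asboolP koo kmin.
have h j : (j < k)%N -> (k_integral P lambda S j < +oo)%E.
  by move=> jk; rewrite ltey; apply/eqP => /asboolP/kmin; rewrite leqNgt jk.
rewrite (k0_least koo h).
have low : {ae P, forall w, (k%:R%:E <= limf_einf (fun t => Y t w) (pinfty_nbhs R))%E}.
  case: k {koo kmin} h => [|k] h.
    apply: aeW => w; apply: (@limf_einf_ge _ _ _ 0) => t _; exact: measure_ge0.
  by have := ae_lower (h k (ltnSn k)); apply: filterS => w [N hN]; exact: limf_einf_ge hN.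
have up := ae_upper koo.
apply: filterS2 low up => w low up; apply/eqP; rewrite eq_le low andbT.
apply: limf_einf_le => M; have [j Mj Yj] := up (Num.truncn M).+1.
by exists j%:R => //; apply: lt_le_trans (truncnS_gt M) _; rewrite ler_nat.
Qed.

End almost_sure.

(** * Limit inferior, transience and recurrence *)

Theorem theorem1 (d : measure_display) (T : measurableType d) (R : realType)
    (P : probability T R) (lambda : R) (S : {RV P >-> R})
    (A V : nat -> {RV P >-> R})
    (lambda_gt0 : 0 < lambda)
    (S_ge0 : forall w, 0 <= S w)
    (queue : MGinfty_queue lambda S A V)
    (ES : ('E_P[S] = +oo)%E) :
  [/\ {ae P, forall w,
        limf_einf (fun t : R => customers A V t w) (pinfty_nbhs R) =
        k0 P lambda S},
      (forall k : nat, (k_integral P lambda S k < +oo)%E) ->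
        {ae P, forall w, customers A V t w @[t --> +oo%R] --> +oo%E}
    & k_integral P lambda S 0 = +oo%E ->
        {ae P, forall w, forall n : nat,
          ~ has_ubound [set t : R | 0 <= t /\ customers A V t w = n%:R%:E]}].
Proof.
split; first exact: ae_limf_einf.
- move=> fin; have := ae_escape lambda_gt0 S_ge0 queue ES fin.
  apply: filterS => w low; apply/cvgeyPge => M.
  have [N hN] := low (Num.truncn M); near=> t.
  apply: le_trans (hN t _); first by rewrite lee_fin; apply/ltW; exact: truncnS_gt.
  by near: t; exists N%:R; split; [exact: num_real|move=> x /ltW].
- move=> koo.
  have inc := ae_increasing_arrivals lambda_gt0 queue.
  have fin := ae_finite_arrivals lambda_gt0 queue.
  have low := ae_upper lambda_gt0 S_ge0 queue koo.
  have large := ae_large lambda_gt0 S_ge0 queue ES.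
  near=> w.
  have visits := @visits_every_state _ _ _ P lambda S A V queue w.
  (* A visit after the integer [(Num.truncn M).+1], which exceeds [M], contradicts the upper bound
     [M]. *)
  move=> n [M ubM]; have [||||t Mt Yt] := visits _ _ _ _ n (Num.truncn M).+1.
  1-4: by near: w.
  have Mlt : M < t by apply: lt_le_trans Mt; exact: truncnS_gt.
  have t0 : 0 <= t by exact: le_trans Mt.
  by have := ubM t (conj t0 Yt); rewrite leNgt Mlt.
Unshelve. all: by end_near. Qed.
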